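(* Let $(M,g)$ be a compact holomorphically separable Kähler manifold with smooth boundary. If $\mu$ is a bounded measure on $M$ (i.e. $\mu \in (C(M))^*$) and $$\int_M u_1 u_2 \, d\mu = 0$$ for any $u_1, u_2 \in C^{\infty}(M)$ with $\Delta_g u_j = 0$ in $M$ ($j=1,2$), then $\mu = 0$.
   Context: $M$ is a compact complex manifold with smooth boundary and $g$ is a Kähler metric on $M$; $M^{\mathrm{int}}$ denotes the interior of $M$. $C(M)$ and $C^\infty(M)$ denote the spaces of complex-valued continuous functions on $M$ and of complex-valued functions smooth up to the boundary, respectively. $(C(M))^*$ is the dual of $C(M)$ with the supremum norm, i.e. the finite complex Borel measures on $M$. $\Delta_g$ is the Laplace-Beltrami operator of $g$. $M$ is called holomorphically separable if for any $x, y \in M$ with $x \neq y$ there is $f \in C^{\infty}(M)$ that is holomorphic in $M^{\mathrm{int}}$ such that $f(x) \neq f(y)$. *)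

(* Defs.v *)
From HB Require Import structures.
From mathcomp Require Import all_boot all_order all_algebra.
From mathcomp Require Import all_classical all_reals all_analysis.
From mathcomp Require Import complex.

Set Implicit Arguments.
Unset Strict Implicit.
Unset Printing Implicit Defensive.

Import Order.TTheory GRing.Theory Num.Theory.
Import numFieldNormedType.Exports.

Local Open Scope classical_set_scope.
Local Open Scope ring_scope.
Local Open Scope complex_scope.

Section HalfSpace.
Context {R : realType} {m : nat}.
Implicit Types (f : 'rV[R]_m -> R) (F : 'rV[R]_m -> R[i]) (x : 'rV[R]_m).

(* The conditions are on the coordinate of index 0; quantifying over indices
   keeps the definition meaningful for m = 0, where there is no boundary. *)
Definition half_space : set 'rV[R]_m :=
  [set x | forall a : 'I_m, val a = 0%N -> 0 <= x 0 a].

Definition open_half_space : set 'rV[R]_m :=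
  [set x | forall a : 'I_m, val a = 0%N -> 0 < x 0 a].

Definition quotient_along (a : 'I_m) f x (t : R) : R :=
  t^-1 * (f (x + t *: delta_mx 0 a) - f x).

(* Increments t that keep x + t e_a in the half space: the usual punctured
   neighbourhoods of 0 when x is interior, one-sided ones in the normal
   direction when x is on the boundary. *)
Definition increments (a : 'I_m) x : set_system R :=
  within [set t | half_space (x + t *: delta_mx 0 a)] 0^'.

Definition pderivable (a : 'I_m) f x : Prop :=
  cvg (quotient_along a f x @ increments a x).

Definition pderiv (a : 'I_m) f x : R :=
  lim (quotient_along a f x @ increments a x).

Definition pderivC (a : 'I_m) F x : R[i] :=
  pderiv a (fun y => complex.Re (F y)) x
    +i* pderiv a (fun y => complex.Im (F y)) x.

(* V is meant to be relatively open in the half space; there, having continuous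
   partial derivatives of all orders (one-sided at the boundary) amounts to
   extending locally to a smooth function on R^m. *)
Fixpoint Ck_on (k : nat) (V : set 'rV[R]_m) f : Prop :=
  {within V, continuous f} /\
  if k is k'.+1 then
    (forall a x, V x -> pderivable a f x) /\
    (forall a, Ck_on k' V (pderiv a f))
  else True.

Definition smooth_on (V : set 'rV[R]_m) f : Prop := forall k, Ck_on k V f.

Definition smoothC_on (V : set 'rV[R]_m) F : Prop :=
  smooth_on V (fun y => complex.Re (F y)) /\
  smooth_on V (fun y => complex.Im (F y)).

(* Column b of the Jacobian matrix is the derivative along e_b, so that it acts
   on the left on column vectors. *)
Definition jacobian_matrix (T : 'rV[R]_m -> 'rV[R]_m) x : 'M[R]_m :=
  \matrix_(a, b) pderiv b (fun y => T y 0 a) x.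

(* |G|^(-1/2) d_a (|G|^(1/2) G^{ab} d_b f) *)
Definition laplace_beltrami (G : 'rV[R]_m -> 'M[R]_m) f x : R :=
  (Num.sqrt (\det (G x)))^-1 *
  \sum_a pderiv a (fun y => Num.sqrt (\det (G y)) *
                            \sum_b invmx (G y) a b * pderiv b f y) x.

Definition laplace_beltramiC (G : 'rV[R]_m -> 'M[R]_m) F x : R[i] :=
  laplace_beltrami G (fun y => complex.Re (F y)) x
    +i* laplace_beltrami G (fun y => complex.Im (F y)) x.

End HalfSpace.

Section Charts.
Context {R : realType} {m : nat} {M : topologicalType}.

Record chart := Chart {
  dom : set M;
  coord : M -> 'rV[R]_m;
  param : 'rV[R]_m -> M;
  dom_open : open dom;
  coordK : forall p, dom p -> param (coord p) = p;
  codom_open : exists2 W, open W & coord @` dom = W `&` half_space;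
  coord_continuous : {within dom, continuous coord};
  param_continuous : {within coord @` dom, continuous param}
}.

Definition chart_codom (c : chart) : set 'rV[R]_m := coord c @` dom c.

Definition overlap (c d : chart) : set 'rV[R]_m :=
  coord c @` (dom c `&` dom d).

Definition transition (c d : chart) (x : 'rV[R]_m) : 'rV[R]_m :=
  coord d (param c x).

Definition smooth_transition (c d : chart) : Prop :=
  forall a, smooth_on (overlap c d) (fun x => transition c d x 0 a).

Definition compatible (c d : chart) : Prop :=
  smooth_transition c d /\ smooth_transition d c.

Definition jac (c d : chart) (x : 'rV[R]_m) : 'M[R]_m :=
  jacobian_matrix (transition c d) x.

End Charts.
Arguments chart : clear implicits.

(* Multiplication by i on C^n = R^n x R^n, with coordinates
   (Re z_1, .., Re z_n, Im z_1, .., Im z_n). *)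
Definition standard_J (R : realType) (n : nat) : 'M[R]_(n + n) :=
  block_mx 0 (- 1%:M) 1%:M 0.

Definition interior_point (R : realType) (m : nat) (M : topologicalType)
    (I : Type) (atlas : I -> chart R m M) : set M :=
  [set p | exists i, dom (atlas i) p /\ open_half_space (coord (atlas i) p)].

(* A smooth manifold with boundary whose interior is a complex manifold, with
   complex structure smooth up to the boundary.  Multiplication by i on the
   tangent spaces is recorded by its components J in the charts of the atlas;
   in a chart where J is standard_J, the maps z_k = x_k + i x_(n+k) are
   holomorphic coordinates.  Such charts are only required around interior
   points: at the boundary they need not exist. *)
Record complex_manifold (R : realType) (n : nat) (M : topologicalType) :=
  ComplexManifold {
  cm_hausdorff : hausdorff_space M;
  cm_second_countable : @second_countable M;
  cm_index : Type;
  cm_atlas : cm_index -> chart R (n + n) M;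
  cm_cover : forall p, exists i, dom (cm_atlas i) p;
  cm_compatible : forall i j, compatible (cm_atlas i) (cm_atlas j);
  cm_J : cm_index -> 'rV[R]_(n + n) -> 'M[R]_(n + n);
  cm_J_smooth : forall i a b,
    smooth_on (chart_codom (cm_atlas i)) (fun x => cm_J i x a b);
  cm_J_tensor : forall i j x, overlap (cm_atlas i) (cm_atlas j) x ->
    jac (cm_atlas i) (cm_atlas j) x *m cm_J i x =
    cm_J j (transition (cm_atlas i) (cm_atlas j) x)
      *m jac (cm_atlas i) (cm_atlas j) x;
  cm_J_square : forall i x, chart_codom (cm_atlas i) x ->
    cm_J i x *m cm_J i x = - 1%:M;
  cm_holomorphic_charts : forall p, interior_point cm_atlas p ->
    exists c : chart R (n + n) M,
      [/\ dom c p, dom c `<=` interior_point cm_atlas,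
          forall i, compatible (cm_atlas i) c &
          forall i x, overlap (cm_atlas i) c x ->
            jac (cm_atlas i) c x *m cm_J i x =
            standard_J R n *m jac (cm_atlas i) c x]
}.

Section Functions.
Context {R : realType} {n : nat} {M : topologicalType}.
Variable X : complex_manifold R n M.

Definition in_chart (i : cm_index X) (u : M -> R[i]) : 'rV[R]_(n + n) -> R[i] :=
  fun x => u (param (cm_atlas i) x).

Definition smooth_function (u : M -> R[i]) : Prop :=
  forall i, smoothC_on (chart_codom (cm_atlas i)) (in_chart i u).

(* du o J = i du at every interior point, i.e. the (0,1)-part of du vanishes. *)
Definition holomorphic_in_interior (u : M -> R[i]) : Prop :=
  forall (i : cm_index X) p,
    dom (cm_atlas i) p -> interior_point (@cm_atlas _ _ _ X) p ->
    forall a : 'I_(n + n),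
      let x := coord (cm_atlas i) p in
      \sum_b pderivC b (in_chart i u) x * (cm_J i x b a)%:C =
      'i * pderivC a (in_chart i u) x.

Definition holomorphically_separable : Prop :=
  forall x y : M, x <> y ->
    exists f, [/\ smooth_function f, holomorphic_in_interior f & f x <> f y].

(* The fundamental form is w(u, v) = g(J u, v), with matrix J^T G. *)
Definition fundamental_form (J G : 'rV[R]_(n + n) -> 'M[R]_(n + n))
    (a b : 'I_(n + n)) (x : 'rV[R]_(n + n)) : R :=
  ((J x)^T *m G x) a b.

Record kahler_metric := KahlerMetric {
  km_g : cm_index X -> 'rV[R]_(n + n) -> 'M[R]_(n + n);
  km_smooth : forall i a b,
    smooth_on (chart_codom (cm_atlas i)) (fun x => km_g i x a b);
  km_tensor : forall (i j : cm_index X) x,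
    overlap (cm_atlas i) (cm_atlas j) x ->
    km_g i x =
    (jac (cm_atlas i) (cm_atlas j) x)^T
      *m km_g j (transition (cm_atlas i) (cm_atlas j) x)
      *m jac (cm_atlas i) (cm_atlas j) x;
  km_sym : forall (i : cm_index X) x, chart_codom (cm_atlas i) x ->
    (km_g i x)^T = km_g i x;
  km_pos : forall (i : cm_index X) x, chart_codom (cm_atlas i) x ->
    forall v : 'cV[R]_(n + n), v != 0 -> 0 < (v^T *m km_g i x *m v) 0 0;
  km_hermitian : forall (i : cm_index X) x, chart_codom (cm_atlas i) x ->
    (cm_J i x)^T *m km_g i x *m cm_J i x = km_g i x;
  km_closed : forall (i : cm_index X) x, chart_codom (cm_atlas i) x ->
    forall a b c,
      let w := fundamental_form (cm_J i) (km_g i) in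
      pderiv a (w b c) x + pderiv b (w c a) x + pderiv c (w a b) x = 0
}.

Definition harmonic_function (g : kahler_metric) (u : M -> R[i]) : Prop :=
  forall (i : cm_index X) x, chart_codom (cm_atlas i) x ->
    laplace_beltramiC (km_g g i) (in_chart i u) x = 0.

End Functions.

(* R[i] has no topology of its own in the library; R[i]^o carries the one
   defined by the modulus. *)
Definition continuousC (R : realType) (M : topologicalType) (f : M -> R[i]) :
    Prop :=
  continuous (f : M -> R[i]^o).

Definition sup_norm (R : realType) (M : topologicalType) (f : M -> R[i]) : R :=
  sup [set Normc.normc (f p) | p in [set: M]].

(* The elements of (C(M))^*; integration against the measure is the duality
   pairing.  The values at discontinuous functions are irrelevant. *)
Record bounded_measure (R : realType) (M : topologicalType) := BoundedMeasure {
  bm_integral :> (M -> R[i]) -> R[i];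
  bm_add : forall f h : M -> R[i], continuousC f -> continuousC h ->
    bm_integral (fun p => f p + h p) = bm_integral f + bm_integral h;
  bm_scale : forall (z : R[i]) (f : M -> R[i]), continuousC f ->
    bm_integral (fun p => z * f p) = z * bm_integral f;
  bm_bounded : exists K : R, forall f : M -> R[i], continuousC f ->
    Normc.normc (bm_integral f) <= K * sup_norm f
}.

(* Main.v *)
Require Import Defs.
From mathcomp Require Import all_boot all_order all_algebra.
From mathcomp Require Import all_classical all_reals all_analysis.
From mathcomp Require Import perm complex ring lra.
Import Order.TTheory GRing.Theory Num.Theory.
Import numFieldNormedType.Exports.
Local Open Scope classical_set_scope.
Local Open Scope ring_scope.
Local Open Scope complex_scope.
Set Implicit Arguments.
Unset Strict Implicit.
Unset Printing Implicit Defensive.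

(** The measure vanishes on a dense set of products of harmonic functions.

    On a Kaehler manifold a holomorphic function [f] and its conjugate are both
    harmonic, so that [mu] vanishes on the products [u * v^*] with [u] and [v]
    holomorphic and smooth up to the boundary, hence on the complex algebra that
    they span ([mixed_span]). This algebra contains the constants, is closed
    under conjugation ([mixed_spanM], [mixed_span_conj]), and separates the
    points of [M] because holomorphic functions do
    ([real_mixed_span_separates]). By the Stone-Weierstrass theorem
    ([stone_weierstrass]) its real-valued elements are uniformly dense in the
    real continuous functions, and [mu], being bounded, vanishes on the real and
    on the imaginary part of every continuous function.

    Harmonicity ([holomorphic_harmonic]) is proved in an arbitrary real chart,
    without holomorphic coordinates, which need not exist at the boundary. Let
    [J] be the complex structure, [G] the metric and [w = J^T *m G] the matrix
    of the fundamental form. The Cauchy-Riemann equations ([cauchy_riemann])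
    read [du = c (dh o J)], where [u] is the real or imaginary part of [f], [h]
    is the other one and [c = 1] or [-1]; they pass from the interior to the
    boundary by continuity. Since [invmx G *m J^T = - invmx w], the gradient
    of [u] is a constant times the Hamiltonian vector field of [h] for the
    symplectic form [w], and since [\det J ^+ 2 = \det (- 1)], the Riemannian
    density [\sqrt (\det G)] is the Liouville density of [w]. A Hamiltonian
    field preserves the Liouville measure, that is, its divergence vanishes
    ([hamiltonian_divergence]): this is where [dw = 0] is used, together with
    Jacobi's formula ([has_pderiv_det]) and the symmetry of second derivatives
    ([pderiv_comm]), which holds up to the boundary. *)

(** * The Stone-Weierstrass theorem *)

Section StoneWeierstrass.
Context {R : realType} {M : topologicalType}.
Implicit Types (f g h v w : M -> R) (A : set (M -> R)).

(** Dini's argument: local solutions [i] of [P i] around each point combine into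
    one solution that works everywhere, because the up-sets of a directed family
    form a filter and compact sets have the near-covering property. *)
Lemma compact_directed (I : Type) (D : set I) (le : I -> I -> Prop)
    (P : I -> M -> Prop) :
  compact [set: M] -> D !=set0 ->
  (forall i j, D i -> D j -> exists2 k, D k & le i k /\ le j k) ->
  (forall i j k, le i j -> le j k -> le i k) ->
  (forall i j p, le i j -> P i p -> P j p) ->
  (forall p : M, exists2 i, D i & \forall q \near p, P i q) ->
  exists2 i, D i & forall p, P i p.
Proof.
move=> /compact_near_coveringP cM D0 Ddir letr Pmono Ploc.
pose up i := [set j | D j /\ le i j].
pose F := filter_from D up.
have FF : Filter F.
  apply: filter_from_filter => // i j Di Dj.
  have [k Dk [ik jk]] := Ddir _ _ Di Dj.
  exists k => // l [Dl kl].
  by split; split=> //; [exact: letr kl|exact: letr kl].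
have [p _|i Di iP] := cM I F P FF.
  have [i Di Pi] := Ploc p.
  exists ([set q | P i q], up i); first by split => //=; exists i.
  by move=> [q j] /= [Piq [_ ij]]; exact: Pmono ij Piq.
have [j Dj [ij _]] := Ddir _ _ Di Di.
by exists j => // p; apply: iP.
Qed.

Lemma compact_bounded_fun f : compact [set: M] -> continuous f ->
  exists2 B, 0 < B & forall p, `|f p| <= B.
Proof.
move=> cM cf.
have /compact_bounded : compact (f @` [set: M]).
  by apply: continuous_compact => //; apply: continuous_subspaceT.
move=> [B [Br HB]].
exists (`|B| + 1) => [|p]; first by rewrite ltr_wpDl.
apply: HB; last by exists p.
by rewrite (le_lt_trans (ler_norm _)) // ltrDl.
Qed.

(** Polynomials in [t] that increase to [`|t|] on [-1, 1]: one step of Newton's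
    method for the square root of [t ^+ 2], with the divisor [2 * q] frozen at
    [q = 1]. *)
Fixpoint abs_poly (n : nat) (t : R) : R :=
  if n is k.+1 then abs_poly k t + (t ^+ 2 - abs_poly k t ^+ 2) / 2 else 0.

(** One step multiplies the error [`|t| - q] by [1 - (`|t| + q) / 2], hence by at
    most [1 - u] with [u = `|t| / 2], and [(1 - u) * (1 + (n + 1) * u) <= 1 + n * u]. *)
Lemma abs_poly_bound n t : `|t| <= 1 ->
  [/\ 0 <= abs_poly n t, abs_poly n t <= `|t| &
      (`|t| - abs_poly n t) * (1 + n%:R * (`|t| / 2)) <= `|t|].
Proof.
move=> t1; have t0 := normr_ge0 t.
elim: n => [|n [q0 qt qn]]; first by split => //=; rewrite mul0r addr0 mulr1 subr0.
rewrite /= -[t ^+ 2]real_normK ?num_real //.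
move: (abs_poly n t) (`|t|) t0 t1 q0 qt qn => q u u0 u1 q0 qu qn.
split; [nra|nra|].
rewrite -[n.+1%:R]natr1; move: (n%:R : R) (ler0n R n) qn => N N0 qn.
have -> : (u - (q + (u ^+ 2 - q ^+ 2) / 2)) * (1 + (N + 1) * (u / 2)) =
  (u - q) * ((1 - u / 2) * (1 + (N + 1) * (u / 2)))
  - (u - q) * (q / 2) * (1 + (N + 1) * (u / 2)) by field.
apply: le_trans qn.
have d0 : 0 <= u - q by rewrite subr_ge0.
have h1 : (1 - u / 2) * (1 + (N + 1) * (u / 2)) <= 1 + N * (u / 2).
  have : 0 <= (N + 1) * u ^+ 2 by rewrite mulr_ge0 ?exprn_ge0 ?addr_ge0.
  by nra.
have h2 : 0 <= (u - q) * (q / 2) * (1 + (N + 1) * (u / 2)).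
  rewrite mulr_ge0 ?(mulr_ge0 d0) ?divr_ge0 // addr_ge0 // mulr_ge0 ?divr_ge0 //.
  by rewrite addr_ge0.
by apply: le_trans (ler_wpM2l d0 h1); rewrite lerBlDr lerDl.
Qed.

Lemma abs_poly_cvg (e : R) : 0 < e ->
  exists n, forall t, `|t| <= 1 -> `| `|t| - abs_poly n t| <= e.
Proof.
move=> e0; exists (Num.truncn (2 / e)).+1 => t t1.
have [q0 qt] := abs_poly_bound (Num.truncn (2 / e)).+1 t1.
have := truncnS_gt (2 / e).
move: (Num.truncn _).+1 q0 qt => n q0 qt.
have d0 : 0 <= `|t| - abs_poly n t by rewrite subr_ge0.
rewrite (ger0_norm d0) ltr_pdivrMr // => ne.
move: d0 => _; have := normr_ge0 t; rewrite le_eqVlt => /orP[/eqP t0|t0].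
  by move: q0 qt; rewrite -t0 => *; nra.
move: (abs_poly n t) (`|t|) q0 qt t0 {t1} => q u q0 qu u0 h.
have {h} : (u - q) * (n%:R / 2) <= 1.
  rewrite -(ler_pM2r u0) mul1r.
  apply: le_trans h; rewrite mulrDr mulr1 !mulrA; nra.
by move=> h; nra.
Qed.

Definition unif_closure A : set (M -> R) :=
  [set v | forall e, 0 < e -> exists2 a, A a & forall p, `|v p - a p| <= e].

Record subalgebra A : Prop := Subalgebra {
  subalgebra_continuous : forall v, A v -> continuous v;
  subalgebra_cst : forall c, A (fun=> c);
  subalgebra_add : forall v w, A v -> A w -> A (fun p => v p + w p);
  subalgebra_mul : forall v w, A v -> A w -> A (fun p => v p * w p)
}.

Variable A : set (M -> R).
Hypothesis (cM : compact [set: M]) (algA : subalgebra A).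

Let Ascale c v : A v -> A (fun p => c * v p).
Proof.
by move=> Av; apply: (subalgebra_mul algA) => //; exact: subalgebra_cst.
Qed.

Lemma unif_closure_sub v : A v -> unif_closure A v.
Proof. by move=> Av e e0; exists v => // p; rewrite subrr normr0 ltW. Qed.

Lemma unif_closureD v w : unif_closure A v -> unif_closure A w ->
  unif_closure A (fun p => v p + w p).
Proof.
move=> cv cw e e0; have e2 : 0 < e / 2 by rewrite divr_gt0.
have [a Aa va] := cv _ e2; have [b Ab wb] := cw _ e2.
exists (fun p => a p + b p) => [|p]; first exact: subalgebra_add.
rewrite opprD addrACA (le_trans (ler_normD _ _)) //.
by rewrite [e in _ <= e]splitr lerD.
Qed.

Lemma unif_closureZ c v : unif_closure A v -> unif_closure A (fun p => c * v p).
Proof.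
move=> cv e e0; have [->|c0] := eqVneq c 0.
  exists (fun=> 0) => [|p]; first exact: subalgebra_cst.
  by rewrite mul0r subrr normr0 ltW.
have ec : 0 < e / `|c| by rewrite divr_gt0 // normr_gt0.
have [a Aa va] := cv _ ec.
exists (fun p => c * a p) => [|p]; first exact: Ascale.
by rewrite -mulrBr normrM mulrC -ler_pdivlMr ?normr_gt0.
Qed.

Lemma unif_closure_abs_sub v : A v -> unif_closure A (fun p => `|v p|).
Proof.
move=> Av e e0.
have [B B0 vB] := compact_bounded_fun cM (subalgebra_continuous algA Av).
have [n qn] := abs_poly_cvg (divr_gt0 e0 B0).
have Aq k : A (fun p => abs_poly k (B^-1 * v p)).
  elim: k => [|k IH] /=; first exact: subalgebra_cst.
  apply: (subalgebra_add algA) => //.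
  under eq_fun do rewrite mulrC.
  apply: Ascale; apply: (subalgebra_add algA).
    under eq_fun do rewrite expr2.
    by apply: (subalgebra_mul algA); apply: Ascale.
  under eq_fun do rewrite -mulN1r expr2.
  by apply: Ascale; apply: (subalgebra_mul algA).
(* Rescaling by a bound [B] of [v] brings the values into [-1, 1]. *)
exists (fun p => B * abs_poly n (B^-1 * v p)) => [|p]; first exact: Ascale.
have nB : `|B^-1 * v p| = B^-1 * `|v p|.
  by rewrite normrM gtr0_norm ?invr_gt0.
have le1 : `|B^-1 * v p| <= 1 by rewrite nB mulrC ler_pdivrMr // mul1r.
have := qn _ le1; rewrite nB ler_pdivlMr //; apply: le_trans.
set q := abs_poly _ _.
have -> : `|v p| - B * q = (B^-1 * `|v p| - q) * B.
  by rewrite mulrBl mulrAC mulVf ?gt_eqF // mul1r [q * B]mulrC.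
by rewrite normrM (gtr0_norm B0).
Qed.

(** The absolute value is 1-Lipschitz, so that it passes to uniform limits. *)
Lemma unif_closure_abs v : unif_closure A v -> unif_closure A (fun p => `|v p|).
Proof.
move=> cv e e0; have e2 : 0 < e / 2 by rewrite divr_gt0.
have [a Aa va] := cv _ e2; have [b Ab ab] := unif_closure_abs_sub Aa e2.
exists b => // p; rewrite [e in _ <= e]splitr.
have -> : `|v p| - b p = (`|v p| - `|a p|) + (`|a p| - b p) by ring.
rewrite (le_trans (ler_normD _ _)) // lerD //.
exact: le_trans (ler_dist_dist _ _) (va p).
Qed.

Lemma unif_closure_max v w : unif_closure A v -> unif_closure A w ->
  unif_closure A (fun p => Num.max (v p) (w p)).
Proof.
move=> cv cw.
have cN : unif_closure A (fun p => -1 * w p) by apply: unif_closureZ.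
have cabs := unif_closure_abs (unif_closureD cv cN).
have := unif_closureZ 2^-1 (unif_closureD (unif_closureD cv cw) cabs).
congr (unif_closure A _); apply/funext => p.
by rewrite maxr_absE mulN1r mulrC.
Qed.

Lemma unif_closure_min v w : unif_closure A v -> unif_closure A w ->
  unif_closure A (fun p => Num.min (v p) (w p)).
Proof.
move=> cv cw.
have := unif_closureZ (-1)
  (unif_closure_max (unif_closureZ (-1) cv) (unif_closureZ (-1) cw)).
congr (unif_closure A _); apply/funext => p.
by rewrite !mulN1r oppr_max !opprK.
Qed.

Hypothesis sepA : forall p q, p <> q -> exists2 a, A a & a p <> a q.

Lemma subalgebra_interpolation f p q :
  exists2 a, A a & a p = f p /\ a q = f q.
Proof.
have [->|pq] := pselect (p = q).
  by exists (fun=> f q) => //; exact: subalgebra_cst.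
have [a Aa /eqP apq] := sepA pq.
exists (fun r => (f p - f q) / (a p - a q) * (a r + - a q) + f q).
  apply: (subalgebra_add algA); last exact: subalgebra_cst.
  by apply: Ascale; apply: (subalgebra_add algA) => //; exact: subalgebra_cst.
by split; [rewrite divfK ?subr_eq0 // subrK|rewrite subrr mulr0 add0r].
Qed.

Let lattice : set (M -> R) := [set v | unif_closure A v /\ continuous v].

Let sub_lattice v : A v -> lattice v.
Proof.
by move=> Av; split; [exact: unif_closure_sub|exact: subalgebra_continuous Av].
Qed.

Let lattice_max v w : lattice v -> lattice w ->
  lattice (fun p => Num.max (v p) (w p)).
Proof.
move=> [cv v'] [cw w']; split; first exact: unif_closure_max.
by move=> p; apply: continuous_max; [exact: v'|exact: w'].
Qed.

Let lattice_min v w : lattice v -> lattice w ->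
  lattice (fun p => Num.min (v p) (w p)).
Proof.
move=> [cv v'] [cw w']; split; first exact: unif_closure_min.
by move=> p; apply: continuous_min; [exact: v'|exact: w'].
Qed.

Let near_lt v w p : continuous v -> continuous w -> v p < w p ->
  \forall q \near p, v q < w q.
Proof.
move=> cv cw vw.
have c : {for p, continuous (fun q => w q - v q)}.
  by apply: continuousB; [exact: cw|exact: cv].
have pos : 0 < w p - v p by rewrite subr_gt0.
by apply: filterS (cvgr_gt _ c _ pos) => q; rewrite /= subr_gt0.
Qed.

(** Uniform approximation from the lattice of uniform limits: for each [p],
    maxima of interpolants give a function above [f - e] everywhere and equal
    to [f] at [p]; minima of those give a function within [e] of [f]. *)
Theorem stone_weierstrass f : continuous f -> unif_closure A f.
Proof.
move=> cf e e0; have e2 : 0 < e / 2 by rewrite divr_gt0.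
have above p : exists2 g, lattice g /\ g p = f p & forall q, f q - e / 2 < g q.
  apply: (@compact_directed _ [set g | lattice g /\ g p = f p]
    (fun g h => forall q, g q <= h q) (fun g q => f q - e / 2 < g q)) => //.
  - exists (fun=> f p); split => //; apply: sub_lattice.
    exact: subalgebra_cst.
  - move=> g h [Lg gp] [Lh hp].
    exists (fun q => Num.max (g q) (h q)).
      by split; [exact: lattice_max|rewrite /= gp hp maxxx].
    by split=> q; rewrite le_max lexx ?orbT.
  - by move=> g h k gh hk q; exact: le_trans (gh q) (hk q).
  - by move=> g h q gh; move/lt_le_trans; apply.
  - move=> q; have [a Aa [ap aq]] := subalgebra_interpolation f p q.
    exists a; first by split=> //; exact: sub_lattice.
    apply: (@near_lt (fun q => f q - e / 2)).
    + move=> r; apply: cvgB; [exact: cf|exact: cvg_cst].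
    + exact: subalgebra_continuous Aa.
    + by rewrite aq ltrBlDr ltrDl.
have [g [[cg _] fg] gf] : exists2 g,
    lattice g /\ (forall q, f q - e / 2 < g q) & forall q, g q < f q + e / 2.
  apply: (@compact_directed _
    [set g | lattice g /\ forall q, f q - e / 2 < g q]
    (fun g h => forall q, h q <= g q) (fun g q => g q < f q + e / 2)) => //.
  - have [[p _]|M0] := pselect (exists p : M, True).
      by have [g [Lg _] fg] := above p; exists g.
    exists (fun=> 0); split.
      by apply: sub_lattice; exact: subalgebra_cst.
    by move=> q; exfalso; apply: M0; exists q.
  - move=> g h [Lg fg] [Lh fh].
    exists (fun q => Num.min (g q) (h q)).
      by split=> [|q]; [exact: lattice_min|rewrite lt_min fg fh].
    by split=> q; rewrite ge_min lexx ?orbT.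
  - by move=> g h k gh hk q; exact: le_trans (hk q) (gh q).
  - by move=> g h q gh; apply: le_lt_trans.
  - move=> p; have [g [Lg gp] fg] := above p; exists g => //.
    apply: (@near_lt g (fun q => f q + e / 2)).
    + by case: Lg.
    + by move=> r; apply: cvgD; [exact: cf|exact: cvg_cst].
    + by rewrite gp ltrDl.
have [a Aa ga] := cg _ e2; exists a => // p.
have -> : f p - a p = (f p - g p) + (g p - a p) by ring.
rewrite (le_trans (ler_normD _ _)) // [e in _ <= e]splitr lerD //.
by rewrite ler_norml; have := fg p; have := gf p; lra.
Qed.

End StoneWeierstrass.

(** * Partial derivatives in a half space *)

Section PartialDerivatives.
Context {R : realType} {m : nat}.
Implicit Types (f g : 'rV[R]_m -> R) (x y : 'rV[R]_m) (a b : 'I_m).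
Implicit Types (V W : set 'rV[R]_m).

Definition relatively_open V : Prop :=
  exists2 W, open W & V = W `&` half_space.

Lemma relatively_open_half V x : relatively_open V -> V x -> half_space x.
Proof. by move=> [W _ ->] []. Qed.

Lemma half_space_shift a x (t : R) : half_space x -> 0 <= t ->
  half_space (x + t *: delta_mx 0 a).
Proof. by move=> hx t0 b b0; rewrite !mxE addr_ge0 ?hx // mulr_ge0. Qed.

#[local] Instance increments_filter a x : Filter (increments a x).
Proof. exact: within_filter. Qed.

(** Positive increments never leave the half space, so that limits along
    [increments] are unique, also at the boundary. *)
Lemma increments_proper a x : half_space x -> ProperFilter (increments a x).
Proof.
move=> hx; apply: Build_ProperFilter_ex => B nB.
have : \forall t \near (0 : R)^'+, B t.
  change (nbhs (0 : R) [set t | t != 0 -> half_space (x + t *: delta_mx 0 a) ->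
    B t]) in nB.
  change (nbhs (0 : R) [set t | 0 < t -> B t]).
  apply: filterS nB.
  move=> t tB t0; apply: tB; first by rewrite gt_eqF.
  by apply: half_space_shift => //; exact: ltW.
by move=> nBr; exact: (@filter_ex _ _ (at_right_proper_filter (0 : R)) _ nBr).
Qed.

Lemma increments_neq0 a x : \forall t \near increments a x, t != 0.
Proof. by apply: filterS (nbhs_dnbhs_neq (0 : R)). Qed.

Lemma cvg_increments a x : t @[t --> increments a x] --> (0 : R).
Proof.
by apply: cvg_within_filter; apply: cvg_within_filter; exact: cvg_id.
Qed.

Lemma cvg_shift_increments a x :
  x + t *: delta_mx 0 a @[t --> increments a x] --> x.
Proof.
rewrite -[X in _ --> X]addr0 -(scale0r (delta_mx 0 a)).
apply: cvgD; first exact: cvg_cst.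
by apply: cvgZr_tmp; exact: cvg_increments.
Qed.

Lemma increments_in V a x : relatively_open V -> V x ->
  \forall t \near increments a x, V (x + t *: delta_mx 0 a).
Proof.
move=> [W oW ->] [Wx hx].
have nW : \forall t \near increments a x, W (x + t *: delta_mx 0 a).
  by apply: cvg_shift_increments; exact: open_nbhs_nbhs.
have nH : \forall t \near increments a x, half_space (x + t *: delta_mx 0 a).
  exact: withinT.
by apply: filterS2 nW nH.
Qed.

(** The derivative as a relation, so that existence and value are handled
    together. *)
Definition has_pderiv a f x (d : R) : Prop :=
  quotient_along a f x @ increments a x --> d.

Lemma pderivableP a f x : pderivable a f x -> has_pderiv a f x (pderiv a f x).
Proof. by []. Qed.

Lemma has_pderiv_val a f x d : half_space x -> has_pderiv a f x d ->
  pderiv a f x = d.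
Proof.
by move=> hx fd; have PF := increments_proper a hx; exact: cvg_lim.
Qed.

Lemma has_pderivable a f x d : has_pderiv a f x d -> pderivable a f x.
Proof. by move=> fd; apply/cvg_ex; exists d. Qed.

(** The functions read in a chart are meaningful on its codomain only; the next
    three lemmas let derivatives ignore the values elsewhere. *)
Lemma eq_in_has_pderiv V a f g x d : relatively_open V -> V x ->
  (forall y, V y -> f y = g y) -> has_pderiv a f x d -> has_pderiv a g x d.
Proof.
move=> oV Vx fg; apply: cvg_trans; apply: near_eq_cvg.
apply: filterS (increments_in a oV Vx) => t Vt.
by rewrite /quotient_along !fg.
Qed.

Lemma eq_in_pderivable V a f g x : relatively_open V -> V x ->
  (forall y, V y -> f y = g y) -> pderivable a f x -> pderivable a g x.
Proof.
move=> oV Vx fg fd; apply: has_pderivable.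
exact: (eq_in_has_pderiv oV Vx fg (pderivableP fd)).
Qed.

Lemma eq_in_pderiv V a f g x : relatively_open V -> V x ->
  (forall y, V y -> f y = g y) -> pderiv a f x = pderiv a g x.
Proof.
move=> oV Vx fg; congr (lim _); apply/seteqP; split; apply: near_eq_cvg;
  by apply: filterS (increments_in a oV Vx) => t Vt; rewrite /quotient_along !fg.
Qed.

Lemma has_pderiv_cvg a f x d : has_pderiv a f x d ->
  f (x + t *: delta_mx 0 a) @[t --> increments a x] --> f x.
Proof.
move=> fd; have : t * quotient_along a f x t + f x @[t --> increments a x] -->
    0 * d + f x.
  by apply: cvgD; [apply: cvgM => //; exact: cvg_increments|exact: cvg_cst].
rewrite mul0r add0r; apply: cvg_trans; apply: near_eq_cvg.
apply: filterS (increments_neq0 a x) => t t0.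
by rewrite /quotient_along mulrA divff // mul1r subrK.
Qed.

Lemma has_pderiv_cst a (c : R) x : has_pderiv a (fun=> c) x 0.
Proof.
rewrite /has_pderiv.
have -> : quotient_along a (fun=> c) x = (fun=> 0).
  by apply/funext => t; rewrite /quotient_along subrr mulr0.
exact: cvg_cst.
Qed.

Lemma has_pderivD a f g x d e : has_pderiv a f x d -> has_pderiv a g x e ->
  has_pderiv a (fun y => f y + g y) x (d + e).
Proof.
move=> fd ge; rewrite /has_pderiv.
have -> : quotient_along a (fun y => f y + g y) x =
    (fun t => quotient_along a f x t + quotient_along a g x t).
  by apply/funext => t; rewrite /quotient_along; ring.
exact: cvgD.
Qed.

Lemma has_pderivM a f g x d e : has_pderiv a f x d -> has_pderiv a g x e ->
  has_pderiv a (fun y => f y * g y) x (f x * e + d * g x).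
Proof.
move=> fd ge; rewrite /has_pderiv.
have -> : quotient_along a (fun y => f y * g y) x =
    (fun t => f (x + t *: delta_mx 0 a) * quotient_along a g x t
              + quotient_along a f x t * g x).
  by apply/funext => t; rewrite /quotient_along; ring.
apply: cvgD; apply: cvgM => //; last exact: cvg_cst.
exact: has_pderiv_cvg fd.
Qed.

Lemma has_pderivZ a (c : R) f x d : has_pderiv a f x d ->
  has_pderiv a (fun y => c * f y) x (c * d).
Proof.
by move=> fd; have := has_pderivM (has_pderiv_cst a c x) fd; rewrite mul0r addr0.
Qed.

Lemma has_pderivN a f x d : has_pderiv a f x d ->
  has_pderiv a (fun y => - f y) x (- d).
Proof.
move=> fd; have := @has_pderivZ a (-1) _ _ _ fd; rewrite mulN1r.
by under eq_fun do rewrite mulN1r.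
Qed.

Lemma has_pderiv_sum (I : finType) (P : pred I) a (F : I -> 'rV[R]_m -> R)
    x (D : I -> R) :
  (forall i, P i -> has_pderiv a (F i) x (D i)) ->
  has_pderiv a (fun y => \sum_(i | P i) F i y) x (\sum_(i | P i) D i).
Proof.
move=> FD; rewrite -[fun y => _]/(fun y => \sum_(i <- index_enum I | P i) F i y).
elim: (index_enum I) => [|i s IH].
  under eq_fun do rewrite big_nil.
  by rewrite big_nil; exact: has_pderiv_cst.
under eq_fun do rewrite big_cons; rewrite big_cons.
have [Pi|//] := boolP (P i).
by apply: has_pderivD => //; exact: FD.
Qed.

Lemma has_pderiv_prod (I : finType) a (F : I -> 'rV[R]_m -> R) x (D : I -> R) :
  (forall i, has_pderiv a (F i) x (D i)) ->
  has_pderiv a (fun y => \prod_i F i y) x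
    (\sum_i D i * \prod_(j | j != i) F j x).
Proof.
move=> FD.
have gen (s : seq I) : uniq s ->
    has_pderiv a (fun y => \prod_(i <- s) F i y) x
      (\sum_(i <- s) D i * \prod_(j <- s | j != i) F j x).
  elim: s => [_|i s IH /= /andP[si us]].
    under eq_fun do rewrite big_nil.
    by rewrite big_nil; exact: has_pderiv_cst.
  under eq_fun do rewrite big_cons.
  have := has_pderivM (FD i) (IH us).
  congr (has_pderiv _ _ _ _).
  rewrite !big_cons eqxx /= addrC; congr (_ + _).
    congr (_ * _); rewrite big_seq [RHS]big_seq_cond.
    by apply: eq_bigl => j; case: eqP => [->|]; rewrite ?(negbTE si) ?andbT.
  rewrite big_distrr /= big_seq [RHS]big_seq; apply: eq_bigr => j js.
  rewrite big_cons mulrCA.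
  by have -> : i != j by apply: contraNneq si => ->.
exact: gen (index_enum_uniq I).
Qed.

(** Caratheodory's form of the derivative of [F] avoids the division by
    increments of [f], which may vanish. *)
Lemma has_pderiv_comp a (F : R -> R) (dF : R) f x d :
  is_derive (f x) 1 F dF -> has_pderiv a f x d ->
  has_pderiv a (fun y => F (f y)) x (dF * d).
Proof.
move=> /is_derive1_caratheodory[h [hF ch <-]] fd; rewrite /has_pderiv.
have -> : quotient_along a (fun y => F (f y)) x =
    (fun t => h (f (x + t *: delta_mx 0 a)) * quotient_along a f x t).
  by apply/funext => t; rewrite /quotient_along hF mulrCA.
apply: cvgM => //.
exact: cvg_comp (has_pderiv_cvg fd) ch.
Qed.

Lemma has_pderivV a f x d : f x != 0 -> has_pderiv a f x d ->
  has_pderiv a (fun y => (f y)^-1) x (- (f x) ^- 2 * d).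
Proof.
move=> f0; apply: (@has_pderiv_comp _ GRing.inv).
rewrite -[X in is_derive _ _ _ X]mulr1.
exact: (@is_deriveV R id (f x) 1 1).
Qed.

Definition has_pderiv_mx p q a (A : 'rV[R]_m -> 'M[R]_(p, q)) x
    (D : 'M[R]_(p, q)) : Prop :=
  forall i j, has_pderiv a (fun y => A y i j) x (D i j).

Lemma has_pderiv_mulmx p q r a (A : 'rV[R]_m -> 'M[R]_(p, q))
    (B : 'rV[R]_m -> 'M[R]_(q, r)) x D E :
  has_pderiv_mx a A x D -> has_pderiv_mx a B x E ->
  has_pderiv_mx a (fun y => A y *m B y) x (A x *m E + D *m B x).
Proof.
move=> AD BE i j.
under eq_fun do rewrite mxE.
rewrite !mxE -big_split /=.
by apply: has_pderiv_sum => k _; apply: has_pderivM.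
Qed.

(** Jacobi's formula: differentiating the product in Leibniz's formula factor by
    factor gives the determinants of [A] with one row differentiated, which
    have the same cofactors along that row as [A]. *)
Lemma has_pderiv_det p a (A : 'rV[R]_m -> 'M[R]_p) x D :
  has_pderiv_mx a A x D ->
  has_pderiv a (fun y => \det (A y)) x (\tr (D *m \adj (A x))).
Proof.
move=> AD.
pose B k : 'M[R]_p := \matrix_(i, j) if i == k then D k j else A x i j.
(* [B k] is [A x] with its row of index [k] replaced by that of [D]. *)
have -> : \tr (D *m \adj (A x)) = \sum_k \det (B k).
  apply: eq_bigr => k _; rewrite (expand_det_row _ k) mxE.
  apply: eq_bigr => l _; rewrite !mxE eqxx; congr (_ * _).
  rewrite /cofactor; congr (_ * \det _); apply/matrixP => i j.
  by rewrite !mxE eq_sym (negbTE (neq_lift _ _)).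
rewrite exchange_big /=.
apply: has_pderiv_sum => s _.
rewrite -mulr_sumr; apply: has_pderivZ.
have := has_pderiv_prod (fun i => AD i (s i)).
congr (has_pderiv _ _ _ _); apply: eq_bigr => k _.
rewrite [RHS](bigD1 k) //= mxE eqxx; congr (_ * _).
by apply: eq_bigr => j jk; rewrite mxE (negbTE jk).
Qed.

Lemma pderivable_cofactor p a (A : 'rV[R]_m -> 'M[R]_p) x D i j :
  has_pderiv_mx a A x D -> pderivable a (fun y => cofactor (A y) i j) x.
Proof.
move=> AD; rewrite /cofactor.
have minorD : has_pderiv_mx a (fun y => row' i (col' j (A y))) x
    (row' i (col' j D)).
  move=> k l; rewrite !mxE.
  by under eq_fun do rewrite !mxE; exact: AD.
have /has_pderivable :=
  has_pderivZ (c := (-1) ^+ (i + j)) (has_pderiv_det minorD).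
by [].
Qed.

(** Cramer's rule gives the existence of the derivative; its value then follows
    by differentiating [invmx A *m A = 1]. *)
Lemma has_pderiv_invmx V p a (A : 'rV[R]_m -> 'M[R]_p) x D :
  relatively_open V -> V x -> (forall y, V y -> A y \in unitmx) ->
  has_pderiv_mx a A x D ->
  has_pderiv_mx a (fun y => invmx (A y)) x
    (- (invmx (A x) *m D *m invmx (A x))).
Proof.
move=> oV Vx uA AD.
have hx := relatively_open_half oV Vx.
pose E := \matrix_(i, j) pderiv a (fun y => invmx (A y) i j) x.
have AE : has_pderiv_mx a (fun y => invmx (A y)) x E.
  move=> i j; rewrite mxE; apply: pderivableP.
  apply: (@eq_in_pderivable V _
    (fun y => (\det (A y))^-1 * cofactor (A y) j i)) => // [y Vy|].
    by rewrite /invmx uA // !mxE.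
  have cD := pderivableP (pderivable_cofactor (i := j) (j := i) AD).
  have := has_pderivable; apply; apply: has_pderivM cD.
  apply: has_pderivV (has_pderiv_det AD).
  by rewrite -unitfE -unitmxE uA.
suff <- : E = - (invmx (A x) *m D *m invmx (A x)) by [].
have mulD : has_pderiv_mx a (fun y => invmx (A y) *m A y) x
    (invmx (A x) *m D + E *m A x) by exact: has_pderiv_mulmx.
have : invmx (A x) *m D + E *m A x = 0.
  apply/matrixP => i j; rewrite [RHS]mxE.
  rewrite -(has_pderiv_val hx (mulD i j)).
  rewrite (@eq_in_pderiv V _ _ (fun=> (1%:M : 'M[R]_p) i j)) // => [|y Vy].
    exact: has_pderiv_val (has_pderiv_cst _ _ _).
  by rewrite mulVmx ?uA.
move=> /(congr1 (mulmx^~ (invmx (A x)))).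
rewrite mulmxDl mul0mx mulmxK ?uA // => /eqP.
by rewrite addrC addr_eq0 => /eqP.
Qed.

End PartialDerivatives.

(** * Functions with continuous partial derivatives *)

Section Smoothness.
Context {R : realType} {m : nat}.
Implicit Types (f g : 'rV[R]_m -> R) (x y : 'rV[R]_m) (a b : 'I_m).
Variable V : set 'rV[R]_m.
Hypothesis oV : relatively_open V.

Let hV x : V x -> half_space x.
Proof. exact: relatively_open_half. Qed.

Let eq_within f g : (forall y, V y -> f y = g y) ->
  {within V, continuous f} -> {within V, continuous g}.
Proof.
by move=> fg; apply: subspace_eq_continuous => y; rewrite inE; exact: fg.
Qed.

Lemma Ck_on_continuous k f : Ck_on k V f -> {within V, continuous f}.
Proof. by case: k => [|k] []. Qed.

Lemma eq_in_Ck_on k f g : (forall y, V y -> f y = g y) ->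
  Ck_on k V f -> Ck_on k V g.
Proof.
elim: k f g => [|k IH] f g fg /= [cf fk].
  by split => //; exact: eq_within cf.
case: fk => df fk; split; first exact: eq_within cf.
split=> [a x Vx|a]; first exact: eq_in_pderivable oV Vx fg (df a x Vx).
by apply: IH (fk a) => y Vy; exact: eq_in_pderiv oV Vy fg.
Qed.

Lemma Ck_onW k f : Ck_on k.+1 V f -> Ck_on k V f.
Proof.
elim: k f => [|k IH] f; first by case.
by move=> [cf [df fk]]; split=> //; split=> // a; apply: IH.
Qed.

Lemma Ck_on_cst k (c : R) : Ck_on k V (fun=> c).
Proof.
have cc (d : R) : {within V, continuous (fun=> d : R)}.
  by move=> ?; exact: cvg_cst.
elim: k c => [|k IH] c /=; split => //; split=> [a x Vx|a].
  exact: has_pderivable (has_pderiv_cst _ _ _).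
apply: eq_in_Ck_on (IH 0) => y Vy; apply/esym.
exact: has_pderiv_val (hV Vy) (has_pderiv_cst _ _ _).
Qed.

Lemma Ck_onD k f g : Ck_on k V f -> Ck_on k V g ->
  Ck_on k V (fun y => f y + g y).
Proof.
elim: k f g => [|k IH] f g /=.
  by move=> [cf _] [cg _]; split=> // x; apply: cvgD; [exact: cf|exact: cg].
move=> [cf [df fk]] [cg [dg gk]].
have dfg a x (Vx : V x) :=
  has_pderivD (pderivableP (df a x Vx)) (pderivableP (dg a x Vx)).
split; first by move=> x; apply: cvgD; [exact: cf|exact: cg].
split=> [a x Vx|a]; first by have /has_pderivable := dfg a x Vx.
apply: eq_in_Ck_on (IH _ _ (fk a) (gk a)) => y Vy; apply/esym.
exact: has_pderiv_val (hV Vy) (dfg a y Vy).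
Qed.

Lemma Ck_onM k f g : Ck_on k V f -> Ck_on k V g ->
  Ck_on k V (fun y => f y * g y).
Proof.
elim: k f g => [|k IH] f g.
  by move=> [cf _] [cg _]; split=> // x; apply: cvgM; [exact: cf|exact: cg].
move=> fk1 gk1; have fk0 := Ck_onW fk1; have gk0 := Ck_onW gk1.
case: fk1 gk1 => cf [df fk] [cg [dg gk]].
have dfg a x (Vx : V x) :=
  has_pderivM (pderivableP (df a x Vx)) (pderivableP (dg a x Vx)).
split; first by move=> x; apply: cvgM; [exact: cf|exact: cg].
split=> [a x Vx|a]; first by have /has_pderivable := dfg a x Vx.
apply: eq_in_Ck_on (Ck_onD (IH _ _ fk0 (gk a)) (IH _ _ (fk a) gk0)) => y Vy.
by apply/esym; exact: has_pderiv_val (hV Vy) (dfg a y Vy).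
Qed.

Lemma Ck_onN k f : Ck_on k V f -> Ck_on k V (fun y => - f y).
Proof.
move=> fk; apply: eq_in_Ck_on (Ck_onM (Ck_on_cst k (-1)) fk) => y _.
by rewrite mulN1r.
Qed.

(** At a point with room [s > 0] behind it, the increments in the direction [a]
    are two-sided, and the partial derivative is an ordinary one. *)
Lemma is_derive_along a f y (s : R) : half_space y -> 0 < s ->
  pderivable a f (y + s *: delta_mx 0 a) ->
  is_derive s 1 (fun r : R => f (y + r *: delta_mx 0 a))
    (pderiv a f (y + s *: delta_mx 0 a)).
Proof.
move=> hy s0 /pderivableP fd; set z := y + _ in fd *.
have inH : \forall t \near (0 : R)^', half_space (z + t *: delta_mx 0 a).
  apply: nbhs_dnbhs; near=> t.
  rewrite /z -addrA -scalerDl; apply: half_space_shift => //.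
  rewrite addrC -lerBlDr sub0r ltW //; near: t.
  by apply: lt_nbhsr; rewrite oppr_lt0.
have fd' : quotient_along a f z @ 0^' --> pderiv a f z.
  move=> U /fd UU; apply: filterS2 inH UU.
  by move=> t hz; apply.
have eqq : (fun h : R => h^-1 *: (((fun r : R => f (y + r *: delta_mx 0 a))
     \o shift s) (h *: 1) - f (y + s *: delta_mx 0 a))) = quotient_along a f z.
  apply/funext => h; rewrite /quotient_along /= /z -addrA -scalerDl.
  by rewrite [s + h]addrC /GRing.scale /= mulr1.
split; first by apply/cvg_ex; exists (pderiv a f z); rewrite eqq.
by rewrite /derive eqq; exact: cvg_lim.
Unshelve. all: by end_near. Qed.

Lemma small_square x a b (N : set 'rV[R]_m) : nbhs x N ->
  exists2 h : R, 0 < h & forall s t, 0 <= s <= h -> 0 <= t <= h ->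
    N (x + s *: delta_mx 0 a + t *: delta_mx 0 b).
Proof.
move=> /nbhs_normP[e /= e0 eN].
pose C : R := `|delta_mx 0 a : 'rV[R]_m| + `|delta_mx 0 b : 'rV[R]_m| + 1.
have C0 : 0 < C by rewrite ltr_wpDl // addr_ge0.
exists (e / C) => [|s t /andP[s0 sh] /andP[t0 th]]; first exact: divr_gt0.
apply: eN => /=; rewrite -addrA opprD addrA subrr add0r normrN.
apply: le_lt_trans (ler_normD _ _) _; rewrite !normrZ !ger0_norm //.
have su := ler_wpM2r (normr_ge0 (delta_mx 0 a : 'rV[R]_m)) sh.
have tv := ler_wpM2r (normr_ge0 (delta_mx 0 b : 'rV[R]_m)) th.
apply: le_lt_trans (lerD su tv) _.
by rewrite -mulrDr -ltr_pdivlMl ?divr_gt0 // invf_div divfK ?gt_eqF // ltrDl.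
Qed.

Lemma continuous_along a f y (h : R) : {within V, continuous f} ->
  (forall r, 0 <= r <= h -> V (y + r *: delta_mx 0 a)) ->
  {within `[0, h], continuous (fun r : R => f (y + r *: delta_mx 0 a))}.
Proof.
move=> /subspace_continuousP cf lV; apply/subspace_continuousP => r /= rh.
have Vr : V (y + r *: delta_mx 0 a) by apply: lV; rewrite in_itv /= in rh.
apply: (@cvg_comp _ _ _ (fun t => y + t *: delta_mx 0 a) f _ _ _ _ (cf _ Vr)).
have line : y + t *: delta_mx 0 a @[t --> r] --> y + r *: delta_mx 0 a.
  by apply: cvgD; [exact: cvg_cst|apply: cvgZr_tmp; exact: cvg_id].
move=> U UU; have UU' : nbhs r [set t | V (y + t *: delta_mx 0 a) ->
  U (y + t *: delta_mx 0 a)] := line _ UU.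
change (nbhs r [set t | t \in `[0, h] -> U (y + t *: delta_mx 0 a)]).
apply: filterS UU' => t Ut th; apply: Ut; apply: lV.
by rewrite in_itv in th.
Qed.

(** The second difference of [f] over a square, by the mean value theorem in
    the direction [a] and then [b]. The sides of the square point into the half
    space, so that the derivatives involved are two-sided even when [x] is on
    the boundary. *)
Lemma second_difference a b f x (h : R) : Ck_on 2 V f -> 0 < h ->
  (forall s t, 0 <= s <= h -> 0 <= t <= h ->
    V (x + s *: delta_mx 0 a + t *: delta_mx 0 b)) ->
  exists s t, [/\ 0 <= s <= h, 0 <= t <= h &
    f (x + h *: delta_mx 0 a + h *: delta_mx 0 b) - f (x + h *: delta_mx 0 a)
      - f (x + h *: delta_mx 0 b) + f x =
    pderiv b (pderiv a f) (x + s *: delta_mx 0 a + t *: delta_mx 0 b) * h ^+ 2].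
Proof.
move=> [cf [df /(_ a)[caf [daf _]]]] h0 sq.
have hh : 0 <= h <= h by rewrite lexx ltW.
have zh : 0 <= (0 : R) <= h by rewrite lexx ltW.
have Va s : 0 <= s <= h -> V (x + s *: delta_mx 0 a).
  by move=> sh; have := sq s 0 sh zh; rewrite scale0r addr0.
have Vx : V x by have := Va 0 zh; rewrite scale0r addr0.
have Vb : V (x + h *: delta_mx 0 b).
  by have := sq 0 h zh hh; rewrite scale0r addr0.
have Vba s : 0 <= s <= h ->
    V (x + h *: delta_mx 0 b + s *: delta_mx 0 a).
  by move=> sh; rewrite addrAC; exact: sq.
pose phi (r : R) := f (x + h *: delta_mx 0 b + r *: delta_mx 0 a)
  - f (x + r *: delta_mx 0 a).
pose dphi (r : R) := pderiv a f (x + h *: delta_mx 0 b + r *: delta_mx 0 a)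
  - pderiv a f (x + r *: delta_mx 0 a).
have [s||s sh es] := @MVT _ phi dphi 0 h h0.
- rewrite in_itv => /andP[s0 sh].
  have sI : 0 <= s <= h by rewrite !ltW.
  apply: is_deriveB; apply: is_derive_along => //.
  + exact: hV.
  + by apply: df; exact: Vba.
  + exact: hV.
  + by apply: df; exact: Va.
- move=> r; apply: cvgB.
    exact: (continuous_along cf Vba).
  exact: (continuous_along cf Va).
have sI : 0 <= s <= h by move: sh; rewrite in_itv /= => /andP[? ?]; rewrite !ltW.
pose psi (r : R) := pderiv a f (x + s *: delta_mx 0 a + r *: delta_mx 0 b).
pose dpsi (r : R) :=
  pderiv b (pderiv a f) (x + s *: delta_mx 0 a + r *: delta_mx 0 b).
have [t||t th et] := @MVT _ psi dpsi 0 h h0.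
- rewrite in_itv => /andP[t0 th].
  have tI : 0 <= t <= h by rewrite !ltW.
  apply: is_derive_along => //; first by apply: hV; exact: Va.
  by apply: daf; exact: sq.
- by apply: (continuous_along caf) => r rh; exact: sq.
exists s, t; split=> //.
  by move: th; rewrite in_itv /= => /andP[? ?]; rewrite !ltW.
have -> : pderiv b (pderiv a f) (x + s *: delta_mx 0 a + t *: delta_mx 0 b)
    * h ^+ 2 = dpsi t * (h - 0) * (h - 0) by rewrite subr0 expr2 mulrA.
rewrite -et; have -> : psi h - psi 0 = dphi s.
  by rewrite /psi /dphi scale0r addr0 addrAC.
rewrite -es /phi !scale0r !addr0 [x + h *: delta_mx 0 b + _]addrAC; ring.
Qed.

(** Schwarz's theorem, up to the boundary: the second difference of [f] over a
    small square is symmetric in [a] and [b], and is a value near [x] of either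
    mixed derivative times the area of the square. *)
Theorem pderiv_comm a b f x : Ck_on 2 V f -> V x ->
  pderiv a (pderiv b f) x = pderiv b (pderiv a f) x.
Proof.
move=> f2 Vx.
have cont c d : pderiv d (pderiv c f) y @[y --> within V (nbhs x)] -->
    pderiv d (pderiv c f) x.
  have [_ [_ /(_ c)[_ [_ /(_ d)[cdf _]]]]] := f2.
  by move/subspace_continuousP: cdf; exact.
apply/eqP; rewrite -subr_eq0 -normr_le0 leNgt; apply/negP => e0.
set e : R := `|_| in e0.
have close c d : \forall y \near x, V y ->
    `|pderiv d (pderiv c f) x - pderiv d (pderiv c f) y| < e / 2.
  by have /cvgr_dist_lt/(_ _ (divr_gt0 e0 (@ltr0n R 2))) := cont c d.
have [W oW VE] := oV.
have Wx : nbhs x W by apply: open_nbhs_nbhs; split=> //; move: Vx; rewrite VE => -[].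
have [h h0 sq] := small_square a b
  (filterI (filterI (close a b) (close b a)) Wx).
have sqV s t : 0 <= s <= h -> 0 <= t <= h ->
    V (x + s *: delta_mx 0 a + t *: delta_mx 0 b).
  move=> sh th; rewrite VE; split; first by have [] := sq s t sh th.
  by do 2!(apply: half_space_shift; last by [case/andP: sh|case/andP: th]);
    exact: hV.
have [s [t [sh th e1]]] := second_difference f2 h0 sqV.
have sqV' s' t' : 0 <= s' <= h -> 0 <= t' <= h ->
    V (x + s' *: delta_mx 0 b + t' *: delta_mx 0 a).
  by move=> ? ?; rewrite addrAC; exact: sqV.
have [t' [s' [th' sh' e2]]] := second_difference f2 h0 sqV'.
have {e1 e2} e12 :
    pderiv b (pderiv a f) (x + s *: delta_mx 0 a + t *: delta_mx 0 b) =
    pderiv a (pderiv b f) (x + t' *: delta_mx 0 b + s' *: delta_mx 0 a).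
  have h2 : h ^+ 2 != 0 by rewrite expf_neq0 ?gt_eqF.
  apply: (mulIf h2); refine (etrans (esym e1) (etrans _ e2)).
  by rewrite [x + h *: delta_mx 0 b + _]addrAC; ring.
have [[/(_ (sqV _ _ sh th)) c1 _] _] := sq s t sh th.
have [[_ /(_ (sqV _ _ sh' th')) c2] _] := sq s' t' sh' th'.
rewrite (addrAC x (s' *: _)) in c2.
have : e < e / 2 + e / 2.
  apply: le_lt_trans (ltrD c2 c1); rewrite e12 -[X in _ <= _ + X]normrN opprB.
  by apply: le_trans (ler_normD _ _); rewrite /e addrA subrK.
by rewrite -splitr ltxx.
Qed.

End Smoothness.

(** * Hamiltonian vector fields are divergence free *)

(** Liouville's theorem at a point. Here [P] is the inverse of the matrix of a
    closed 2-form [w], [D a] is the derivative of that matrix along [e_a], [h]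
    and [H] are the first and second derivatives of a function, and [s] is the
    Liouville density, whose logarithmic derivative is [\tr (P *m D a) / 2]. The
    sum is the divergence of the Hamiltonian field [P *m h] multiplied by [s].
    The second derivatives cancel since [P] is antisymmetric; the rest cancels
    because closedness of [w], contracted with [P], is the identity [KE]. *)
Lemma hamiltonian_divergence (R : realType) (m : nat) (P : 'M[R]_m)
    (D : 'I_m -> 'M[R]_m) (h : 'I_m -> R) (H : 'I_m -> 'I_m -> R) (s : R) :
  P^T = - P -> (forall a, (D a)^T = - D a) ->
  (forall a b c, D a b c + D b c a + D c a b = 0) ->
  (forall a b, H a b = H b a) ->
  \sum_a (s * (\sum_b (P a b * H a b + (- (P *m D a *m P)) a b * h b))
          + s / 2 * \tr (P *m D a) * \sum_b P a b * h b) = 0.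
Proof.
move=> /matrixP PT DT Dc Hs.
have PE a b : P a b = - P b a by have := PT b a; rewrite !mxE.
have DE a b c : D a b c = - D a c b.
  by have /matrixP/(_ c b) := DT a; rewrite !mxE.
have PH : \sum_a \sum_b P a b * H a b = 0.
  have E : \sum_a \sum_b P a b * H a b = - \sum_a \sum_b P a b * H a b.
    rewrite [LHS]exchange_big /= -sumrN; apply: eq_bigr => b _.
    by rewrite -sumrN; apply: eq_bigr => a _; rewrite PE Hs mulNr.
  by move: E; set S := \sum_a _; lra.
pose K d := \sum_a \sum_c P a c * D a c d.
have KE d : K d = \tr (P *m D d) / 2.
  have E1 : K d = - \sum_a \sum_c P a c * D c a d.
    rewrite /K exchange_big /= -sumrN; apply: eq_bigr => c _.
    by rewrite -sumrN; apply: eq_bigr => a _; rewrite PE mulNr.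
  have E2 : \tr (P *m D d) = K d - \sum_a \sum_c P a c * D c a d.
    rewrite /K -sumrB; apply: eq_bigr => a _; rewrite mxE -sumrB.
    apply: eq_bigr => c _; rewrite -mulrBr; congr (_ * _).
    have := Dc a c d; rewrite (DE c d a) (DE d a c); lra.
  by rewrite E2 -E1; lra.
have PDP b : \sum_a (P *m D a *m P) a b = \sum_a \tr (P *m D a) / 2 * P a b.
  under eq_bigr do rewrite mxE.
  rewrite exchange_big /=; apply: eq_bigr => d _.
  rewrite -KE -mulr_suml; congr (_ * _); apply: eq_bigr => a _.
  by rewrite mxE.
have PHh : \sum_a \sum_b (P a b * H a b + (- (P *m D a *m P)) a b * h b) =
    - \sum_a \tr (P *m D a) / 2 * \sum_b P a b * h b.
  rewrite (eq_bigr (fun a => \sum_b P a b * H a b +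
    \sum_b (- (P *m D a *m P)) a b * h b)); last by move=> a _; rewrite big_split.
  rewrite big_split /= PH add0r exchange_big /=.
  rewrite [in RHS](eq_bigr (fun a => \sum_b \tr (P *m D a) / 2 * P a b * h b));
    last by move=> a _; rewrite mulr_sumr; apply: eq_bigr => b _; rewrite mulrA.
  rewrite [in RHS]exchange_big /= -sumrN; apply: eq_bigr => b _.
  rewrite -!mulr_suml -mulNr -PDP -sumrN.
  by congr (_ * _); apply: eq_bigr => a _; rewrite mxE.
rewrite big_split /= -mulr_sumr PHh mulrN mulr_sumr -sumrN -big_split /=.
by apply: big1 => a _; field.
Qed.

Section KahlerLaplacian.
Context {R : realType} {m : nat}.
Variables (V : set 'rV[R]_m) (J G : 'rV[R]_m -> 'M[R]_m).
Hypothesis oV : relatively_open V.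
Hypothesis J_pderivable :
  forall a b c x, V x -> pderivable a (fun y => J y b c) x.
Hypothesis G_pderivable :
  forall a b c x, V x -> pderivable a (fun y => G y b c) x.
Hypothesis J_square : forall x, V x -> J x *m J x = - 1%:M.
Hypothesis G_sym : forall x, V x -> (G x)^T = G x.
Hypothesis G_unit : forall x, V x -> G x \in unitmx.
Hypothesis G_hermitian : forall x, V x -> (J x)^T *m G x *m J x = G x.
(* The matrix of the fundamental form. *)
Let w y : 'M[R]_m := (J y)^T *m G y.
Hypothesis w_closed : forall x, V x -> forall a b c,
  pderiv a (fun y => w y b c) x + pderiv b (fun y => w y c a) x
    + pderiv c (fun y => w y a b) x = 0.

Let w_anti x : V x -> (w x)^T = - w x.
Proof.
move=> Vx; rewrite /w trmx_mul trmxK G_sym // -[in LHS](G_hermitian Vx).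
by rewrite -(mulmxA _ (J x) (J x)) J_square // mulmxN mulmx1.
Qed.

Let w_mulV x : V x -> w x *m - (invmx (G x) *m (J x)^T) = 1%:M.
Proof.
move=> Vx; rewrite mulmxN /w mulmxA mulmxK ?G_unit //.
by rewrite -trmx_mul J_square // linearN /= trmx1 opprK.
Qed.

Let w_unit x : V x -> w x \in unitmx.
Proof. by move=> /w_mulV/mulmx1_unit[]. Qed.

Let invw x : V x -> invmx (w x) = - (invmx (G x) *m (J x)^T).
Proof.
by move=> Vx; rewrite -[LHS]mulmx1 -(w_mulV Vx) mulKmx ?w_unit.
Qed.

Let det_w_sqr x : V x -> \det (w x) ^+ 2 = (-1) ^+ m * \det (G x) ^+ 2.
Proof.
move=> Vx; rewrite /w det_mulmx det_tr exprMn; congr (_ * _).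
rewrite expr2 -det_mulmx J_square // -scaleN1r.
by rewrite detZ det1 mulr1.
Qed.

Let Dw a x : 'M[R]_m := \matrix_(b, c) pderiv a (fun y => w y b c) x.

Let w_has_pderiv a x : V x -> has_pderiv_mx a w x (Dw a x).
Proof.
move=> Vx.
have JD : has_pderiv_mx a (fun y => (J y)^T) x
    (\matrix_(b, c) pderiv a (fun y => J y c b) x).
  move=> b c; rewrite mxE; under eq_fun do rewrite mxE.
  by apply: pderivableP; exact: J_pderivable.
have GD : has_pderiv_mx a G x (\matrix_(b, c) pderiv a (fun y => G y b c) x).
  by move=> b c; rewrite mxE; apply: pderivableP; exact: G_pderivable.
have wD : has_pderiv_mx a w x _ := has_pderiv_mulmx JD GD.
by move=> b c; rewrite mxE; apply: pderivableP; exact: has_pderivable (wD b c).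
Qed.

Let Dw_anti a x : V x -> (Dw a x)^T = - Dw a x.
Proof.
move=> Vx; apply/matrixP => b c; rewrite !mxE.
have wD : has_pderiv a (fun y => w y b c) x (Dw a x b c)
  by exact: w_has_pderiv.
rewrite (eq_in_pderiv a oV Vx (g := fun y => - w y b c)) => [|y Vy].
  rewrite (has_pderiv_val (relatively_open_half oV Vx) (has_pderivN wD)).
  by rewrite mxE.
by have /matrixP/(_ b c) := w_anti Vy; rewrite !mxE.
Qed.

(** The derivative of [\det G] is computed from [\det w ^+ 2], which agrees with
    [\det G ^+ 2] up to a constant sign: this spares a discussion of the sign of
    [\det J]. *)
Let det_G_pderiv a x : V x ->
  has_pderiv a (fun y => \det (G y)) x
    (\det (G x) * \tr (invmx (w x) *m Dw a x)).
Proof.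
move=> Vx; have hx := relatively_open_half oV Vx.
have GD : has_pderiv_mx a G x (\matrix_(b, c) pderiv a (fun y => G y b c) x).
  by move=> b c; rewrite mxE; apply: pderivableP; exact: G_pderivable.
have dG := has_pderiv_det GD; move: (\tr _) dG => e dG.
suff <- : e = \det (G x) * \tr (invmx (w x) *m Dw a x) by [].
have G0 : \det (G x) != 0 by rewrite -unitfE -unitmxE G_unit.
have w0 : \det (w x) != 0 by rewrite -unitfE -unitmxE w_unit.
have dw := has_pderiv_det (@w_has_pderiv a x Vx).
have tE : \tr (Dw a x *m \adj (w x)) = \det (w x) * \tr (invmx (w x) *m Dw a x).
  rewrite mxtrace_mulC /invmx w_unit // -scalemxAl mxtraceZ mulrA mulfV //.
  by rewrite mul1r.
rewrite tE in dw.
have E : \det (w x) * (\det (w x) * \tr (invmx (w x) *m Dw a x)) +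
    \det (w x) * \tr (invmx (w x) *m Dw a x) * \det (w x) =
    (-1) ^+ m * (\det (G x) * e + e * \det (G x)).
  rewrite -(has_pderiv_val hx (has_pderivM dw dw)).
  rewrite -(has_pderiv_val hx (has_pderivZ (c := (-1) ^+ m) (has_pderivM dG dG))).
  by apply: (eq_in_pderiv a oV Vx) => y Vy; rewrite -!expr2 det_w_sqr.
move: E (det_w_sqr Vx).
have : (-1) ^+ m * (-1) ^+ m = 1 :> R by rewrite -expr2 sqrr_sign.
move: (\tr _) (\det (w x)) (\det (G x)) G0 {tE dw w0 dG GD} ((-1) ^+ m).
move=> t d g g0 k k1 E d2.
have {}E : d ^+ 2 * t = k * (g * e) by move: E; rewrite expr2; lra.
have : k * (g * e) = k * (g * (g * t)) by rewrite -E d2; ring.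
by move=> /(congr1 ( *%R k)); rewrite !(mulrA k) k1 !mul1r => /(mulfI g0).
Qed.

(** If [df = c (dh o J)] then the gradient of [f] is, up to a constant, the
    Hamiltonian vector field of [h] for the symplectic form [w], and
    [\sqrt (\det G)] is the density of its Liouville measure. *)
Theorem laplace_beltrami_conjugate (c : R) f h x :
  Ck_on 2 V h ->
  (forall y, V y -> forall a,
    pderiv a f y = c * \sum_b J y b a * pderiv b h y) ->
  V x -> laplace_beltrami G f x = 0.
Proof.
move=> h2 fh Vx; have hx := relatively_open_half oV Vx.
rewrite /laplace_beltrami.
(* [Num.sqrt] vanishes on nonpositive numbers, and the inverse of 0 is 0. *)
have [G0|G0] := leP (\det (G x)) 0; first by rewrite ler0_sqrtr // invr0 mul0r.
set s := fun y => Num.sqrt (\det (G y)).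
pose t a := \tr (invmx (w x) *m Dw a x).
have sD a : has_pderiv a s x (s x / 2 * t a).
  have := has_pderiv_comp (is_derive1_sqrt G0) (@det_G_pderiv a x Vx).
  congr (has_pderiv _ _ _ _).
  have s0 : s x != 0 by rewrite gt_eqF // sqrtr_gt0.
  rewrite -/(s x) -/(t a) -[\det (G x)]sqr_sqrtr ?(ltW G0) // -/(s x).
  by field.
have h_pd b : forall y a, V y -> pderivable a (pderiv b h) y.
  by move=> y a Vy; have [_ [_ /(_ b)[_ [/(_ a y Vy)]]]] := h2.
pose S a := \sum_b (invmx (w x) a b * pderiv a (pderiv b h) x
   + (- (invmx (w x) *m Dw a x *m invmx (w x))) a b * pderiv b h x).
have flux a : pderiv a (fun y => s y * \sum_b invmx (G y) a b * pderiv b f y) x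
   = - c * (s x * S a
            + s x / 2 * t a * \sum_b invmx (w x) a b * pderiv b h x).
  rewrite (eq_in_pderiv a oV Vx (g := fun y =>
    - c * (s y * \sum_b invmx (w y) a b * pderiv b h y))) => [|y Vy].
    apply: has_pderiv_val => //; apply: has_pderivZ.
    have PD : has_pderiv_mx a (fun y => invmx (w y)) x _ :=
      has_pderiv_invmx oV Vx w_unit (@w_has_pderiv a x Vx).
    apply: (@has_pderivM _ _ a s
      (fun y => \sum_b invmx (w y) a b * pderiv b h y)) (sD a) _.
    apply: has_pderiv_sum => b _.
    exact: has_pderivM (PD a b) (pderivableP (h_pd _ _ _ Vx)).
  rewrite mulrCA; congr (_ * _).
  rewrite (eq_bigr (fun b =>
    c * \sum_d invmx (G y) a b * (J y d b * pderiv d h y)));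
    last by move=> b _; rewrite fh // mulrCA mulr_sumr.
  rewrite -mulr_sumr exchange_big mulNr -mulrN -sumrN; congr (_ * _).
  apply: eq_bigr => d _; rewrite invw // mxE mulNr opprK mxE mulr_suml.
  by apply: eq_bigr => b _; rewrite mxE mulrA.
under eq_bigr do rewrite flux.
rewrite -mulr_sumr.
rewrite (_ : \sum_a (_ + _) = 0); first by rewrite !mulr0.
apply: (@hamiltonian_divergence _ _ (invmx (w x)) (Dw^~ x)
  (fun b => pderiv b h x) (fun a b => pderiv a (pderiv b h) x) (s x)).
- rewrite trmx_inv w_anti // -scaleN1r invmxZ ?invrN1 ?scaleN1r //.
  by rewrite -w_anti // unitmx_tr w_unit.
- by move=> a; exact: Dw_anti.
- by move=> a b d; have := w_closed Vx a b d; rewrite /Dw !mxE.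
- by move=> a b; exact: pderiv_comm h2 Vx.
Qed.

End KahlerLaplacian.

(** * Holomorphic functions on a Kaehler manifold are harmonic *)

Lemma Re_sumC (R : realType) (I : finType) (F : I -> R[i]) :
  complex.Re (\sum_i F i) = \sum_i complex.Re (F i).
Proof. by apply: (big_morph (@complex.Re R)) => // -[? ?] [? ?]. Qed.

Lemma Im_sumC (R : realType) (I : finType) (F : I -> R[i]) :
  complex.Im (\sum_i F i) = \sum_i complex.Im (F i).
Proof. by apply: (big_morph (@complex.Im R)) => // -[? ?] [? ?]. Qed.

Lemma Ck_on_sum (R : realType) (m k : nat) (V : set 'rV[R]_m) (I : finType)
    (F : I -> 'rV[R]_m -> R) :
  relatively_open V -> (forall i, Ck_on k V (F i)) ->
  Ck_on k V (fun y => \sum_i F i y).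
Proof.
move=> oV Fk; elim: (index_enum I) => [|i s IH].
  by under eq_fun do rewrite big_nil; exact: Ck_on_cst.
by under eq_fun do rewrite big_cons; exact: Ck_onD.
Qed.

(** A boundary point is a limit of interior ones along the inner normal. *)
Lemma eq0_of_open_half (R : realType) (m : nat) (V : set 'rV[R]_m)
    (f : 'rV[R]_m -> R) x :
  relatively_open V -> {within V, continuous f} ->
  (forall y, V y -> open_half_space y -> f y = 0) -> V x -> f x = 0.
Proof.
move=> oV /subspace_continuousP cf f0 Vx.
have hx := relatively_open_half oV Vx.
have [[a a0]|noa] := pselect (exists a : 'I_m, val a = 0%N); last first.
  by apply: f0 => // a a0; case: noa; exists a.
have line : x + t *: delta_mx 0 a @[t --> (0 : R)^'+] --> x.
  rewrite -[X in _ --> X]addr0 -(scale0r (delta_mx 0 a)).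
  apply: cvgD; first exact: cvg_cst.
  by apply: cvgZr_tmp; apply: cvg_within_filter; exact: cvg_id.
have inV : \forall t \near (0 : R)^'+, V (x + t *: delta_mx 0 a).
  have [W oW VE] := oV; rewrite VE in Vx *; have [Wx _] := Vx.
  have nW : \forall t \near (0 : R)^'+, W (x + t *: delta_mx 0 a) :=
    line _ (open_nbhs_nbhs (conj oW Wx)).
  apply: filterS2 nW (nbhs_right_gt (0 : R)) => t Wt t0; split => //.
  by apply: half_space_shift => //; exact: ltW.
have fl : f (x + t *: delta_mx 0 a) @[t --> (0 : R)^'+] --> f x.
  move=> U /(cf _ Vx) UU; have nU : \forall t \near (0 : R)^'+, V (x + t *: delta_mx 0 a) ->
    U (f (x + t *: delta_mx 0 a)) := line _ UU.
  by apply: filterS2 inV nU => t Vt; apply.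
apply: (cvg_unique (@Rhausdorff R) fl).
apply: cvg_near_cst; apply: filterS2 inV (nbhs_right_gt (0 : R)) => t Vt t0.
apply: f0 => // b b0; have -> : b = a by apply: val_inj; rewrite b0 a0.
by rewrite !mxE !eqxx mulr1 ltr_wpDl // hx.
Qed.

Section Manifold.
Context {R : realType} {n : nat} {M : topologicalType}.
Variable X : complex_manifold R n M.
Implicit Types (u v : M -> R[i]) (i : cm_index X).

Let V i : set 'rV[R]_(n + n) := chart_codom (cm_atlas i).
Let re i u := fun y => complex.Re (in_chart i u y).
Let im i u := fun y => complex.Im (in_chart i u y).

Lemma chart_codom_open i : relatively_open (chart_codom (cm_atlas i)).
Proof. exact: codom_open. Qed.

(** The Cauchy-Riemann equations [du o J = i du], which extend to the boundary
    by continuity. *)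
Lemma cauchy_riemann u i x : smooth_function X u ->
  holomorphic_in_interior X u -> V i x -> forall a,
  pderiv a (re i u) x = \sum_b cm_J i x b a * pderiv b (im i u) x /\
  pderiv a (im i u) x = - \sum_b cm_J i x b a * pderiv b (re i u) x.
Proof.
move=> su hu Vx a; have oV := chart_codom_open i.
have [sre sim] := su i.
have inner y : V i y -> open_half_space y ->
    \sum_b pderivC b (in_chart i u) y * (cm_J i y b a)%:C =
    'i * pderivC a (in_chart i u) y.
  move=> [p dp <-] oy.
  have ip : interior_point (@cm_atlas _ _ _ X) p by exists i.
  exact: hu dp ip a.
have cd k f b : smooth_on (V i) f -> Ck_on k (V i) (pderiv b f).
  by move=> /(_ k.+1)[_ [_]]; apply.
have cJ k f : smooth_on (V i) f ->
    Ck_on k (V i) (fun y => \sum_b cm_J i y b a * pderiv b f y).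
  move=> sf; apply: Ck_on_sum => // b; apply: Ck_onM => //; last exact: cd.
  exact: (cm_J_smooth i b a k).
split; apply/eqP; rewrite -subr_eq0; apply/eqP.
- apply: (eq0_of_open_half (f := fun y => pderiv a (re i u) y
    - \sum_b cm_J i y b a * pderiv b (im i u) y) oV) Vx => [|y Vy oy].
    apply: (Ck_on_continuous (k := 0)); apply: Ck_onD => //.
      exact: cd.
    by apply: Ck_onN => //; exact: cJ.
  have /(congr1 (@complex.Im R)) := inner y Vy oy.
  rewrite Im_sumC /pderivC /= mul0r mul1r add0r => <-.
  by rewrite -sumrB; apply: big1 => b _ /=; rewrite mulr0 add0r mulrC subrr.
- apply: (eq0_of_open_half (f := fun y => pderiv a (im i u) y
    - - \sum_b cm_J i y b a * pderiv b (re i u) y) oV) Vx => [|y Vy oy].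
    apply: (Ck_on_continuous (k := 0)); apply: Ck_onD => //.
      exact: cd.
    by do 2!apply: Ck_onN => //; exact: cJ.
  have /(congr1 (@complex.Re R)) := inner y Vy oy.
  rewrite Re_sumC /pderivC /= mul0r mul1r sub0r => E.
  rewrite opprK -[pderiv a _ y]opprK -E addrC -sumrB.
  by apply: big1 => b _ /=; rewrite mulr0 subr0 mulrC subrr.
Qed.

Variable g : kahler_metric X.

Let G_unit i x : V i x -> km_g g i x \in unitmx.
Proof.
move=> Vx; rewrite unitmxE unitfE; apply/negP => /det0P[v v0 vG].
have := @km_pos _ _ _ _ g i x Vx v^T; rewrite trmxK vG mul0mx mxE ltxx.
have -> : v^T != 0 by rewrite -(inj_eq (@trmx_inj _ _ _)) trmxK trmx0.
by move=> /(_ isT).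
Qed.

Let laplace_conjugate i (c : R) f h x : smooth_on (V i) h ->
  (forall y, V i y -> forall a,
    pderiv a f y = c * \sum_b cm_J i y b a * pderiv b h y) ->
  V i x -> laplace_beltrami (km_g g i) f x = 0.
Proof.
move=> sh fh Vx.
apply: (@laplace_beltrami_conjugate _ _ (V i) (cm_J i) (km_g g i)
  (chart_codom_open i) _ _ _ _ _ _ _ c f h) Vx => //.
- by move=> a b d y Vy; have [_ [/(_ a y Vy)]] := cm_J_smooth i b d 1.
- by move=> a b d y Vy; have [_ [/(_ a y Vy)]] := km_smooth g i b d 1.
- exact: cm_J_square.
- exact: km_sym.
- exact: G_unit.
- exact: km_hermitian.
- by move=> y Vy a b d; exact: km_closed Vy a b d.
Qed.

(** By the Cauchy-Riemann equations the gradients of the real and imaginary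
    parts of [u] are the Hamiltonian fields, up to sign, of one another. *)
Theorem holomorphic_harmonic u : smooth_function X u ->
  holomorphic_in_interior X u -> harmonic_function g u.
Proof.
move=> su hu i x Vx; rewrite /laplace_beltramiC.
rewrite (laplace_conjugate (c := 1) (h := im i u)) // => [||y Vy a].
- rewrite (laplace_conjugate (c := -1) (h := re i u)) // => [|y Vy a].
    by case: (su i).
  by have [_ ->] := cauchy_riemann su hu Vy a; rewrite mulN1r.
- by case: (su i).
- by have [-> _] := cauchy_riemann su hu Vy a; rewrite mul1r.
Qed.

Theorem conj_holomorphic_harmonic u : smooth_function X u ->
  holomorphic_in_interior X u -> harmonic_function g (fun p => (u p)^*).
Proof.
move=> su hu i x Vx; rewrite /laplace_beltramiC.
have reE : (fun y => complex.Re (in_chart i (fun p => (u p)^*) y)) = re i u.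
  by apply/funext => y; rewrite /re /in_chart; case: (u _).
have imE : (fun y => complex.Im (in_chart i (fun p => (u p)^*) y)) =
    (fun y => - im i u y).
  by apply/funext => y; rewrite /im /in_chart; case: (u _).
rewrite reE imE.
rewrite (laplace_conjugate (c := 1) (h := im i u)) // => [||y Vy a].
- rewrite (laplace_conjugate (c := 1) (h := re i u)) // => [|y Vy a].
    by case: (su i).
  have [_ sim] := su i; have [_ [dim _]] := sim 1%N.
  rewrite (has_pderiv_val (relatively_open_half (chart_codom_open i) Vy)
    (has_pderivN (pderivableP (dim a y Vy)))).
  by have [_ ->] := cauchy_riemann su hu Vy a; rewrite mul1r opprK.
- by case: (su i).
- by have [-> _] := cauchy_riemann su hu Vy a; rewrite mul1r.
Qed.

(** * The algebra of holomorphic functions smooth up to the boundary *)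

Lemma smooth_functionM u v : smooth_function X u -> smooth_function X v ->
  smooth_function X (fun p => u p * v p).
Proof.
move=> su sv i; have [ru iu] := su i; have [rv iv] := sv i.
have oV := chart_codom_open i.
split=> k.
- apply: (eq_in_Ck_on oV _ (Ck_onD oV (Ck_onM oV (ru k) (rv k))
    (Ck_onN oV (Ck_onM oV (iu k) (iv k))))) => y _.
  by rewrite /in_chart; case: (u _) (v _) => [? ?] [? ?].
- apply: (eq_in_Ck_on oV _ (Ck_onD oV (Ck_onM oV (ru k) (iv k))
    (Ck_onM oV (iu k) (rv k)))) => y _.
  by rewrite /in_chart; case: (u _) (v _) => [? ?] [? ?].
Qed.

Lemma smooth_function_conj u : smooth_function X u ->
  smooth_function X (fun p => (u p)^*).
Proof.
move=> su i; have [ru iu] := su i; have oV := chart_codom_open i.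
split=> k.
- apply: (eq_in_Ck_on oV _ (ru k)) => y _.
  by rewrite /in_chart; case: (u _).
- apply: (eq_in_Ck_on oV _ (Ck_onN oV (iu k))) => y _.
  by rewrite /in_chart; case: (u _).
Qed.

Lemma smooth_function_cst (z : R[i]) : smooth_function X (fun=> z).
Proof.
by move=> i; split=> k; apply: Ck_on_cst; exact: chart_codom_open.
Qed.

Lemma holomorphic_cst (z : R[i]) : holomorphic_in_interior X (fun=> z).
Proof.
move=> i p dp _ a x.
have hx : half_space x.
  by apply: (relatively_open_half (chart_codom_open i)); exists p.
have d0 b : pderivC b (in_chart i (fun=> z)) x = 0.
  rewrite /pderivC /in_chart.
  by rewrite !(has_pderiv_val hx (has_pderiv_cst _ _ _)).
by rewrite d0 mulr0; apply: big1 => b _; rewrite d0 mul0r.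
Qed.

Lemma holomorphicM u v : smooth_function X u -> smooth_function X v ->
  holomorphic_in_interior X u -> holomorphic_in_interior X v ->
  holomorphic_in_interior X (fun p => u p * v p).
Proof.
move=> su sv hu hv i p dp ip a x.
have Vx : V i x by exists p.
have hx := relatively_open_half (chart_codom_open i) Vx.
have leibniz b : pderivC b (in_chart i (fun q => u q * v q)) x =
    pderivC b (in_chart i u) x * in_chart i v x
    + in_chart i u x * pderivC b (in_chart i v) x.
  have [/(_ 1%N)[_ [dru _]] /(_ 1%N)[_ [diu _]]] := su i.
  have [/(_ 1%N)[_ [drv _]] /(_ 1%N)[_ [div _]]] := sv i.
  have {}dru := pderivableP (dru b x Vx); have {}diu := pderivableP (diu b x Vx).
  have {}drv := pderivableP (drv b x Vx); have {}div := pderivableP (div b x Vx).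
  rewrite /pderivC.
  have reE : (fun y => complex.Re (in_chart i (fun q => u q * v q) y)) =
      (fun y => re i u y * re i v y + - (im i u y * im i v y)).
    by apply/funext => y; rewrite /re /im /in_chart; case: (u _) (v _) => [? ?] [? ?].
  have imE : (fun y => complex.Im (in_chart i (fun q => u q * v q) y)) =
      (fun y => re i u y * im i v y + im i u y * re i v y).
    by apply/funext => y; rewrite /re /im /in_chart; case: (u _) (v _) => [? ?] [? ?].
  rewrite reE imE.
  rewrite (has_pderiv_val hx (has_pderivD (has_pderivM dru drv)
    (has_pderivN (has_pderivM diu div)))).
  rewrite (has_pderiv_val hx (has_pderivD (has_pderivM dru div)
    (has_pderivM diu drv))).
  rewrite /re /im; case: (in_chart i u x) (in_chart i v x) => [a1 a2] [b1 b2].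
  by apply/eqP; rewrite eq_complex /=; apply/andP; split; apply/eqP; ring.
rewrite leibniz mulrDr mulrA -(hu i p dp ip a) mulrCA -(hv i p dp ip a).
rewrite mulr_suml mulr_sumr -big_split /=; apply: eq_bigr => b _.
by rewrite leibniz -/x; ring.
Qed.

End Manifold.

(** * Density of products of harmonic functions *)

Lemma normc_ge0 (R : realType) (z : R[i]) : 0 <= Normc.normc z.
Proof. by case: z => a b; exact: sqrtr_ge0. Qed.

Lemma normc_le_ReIm (R : realType) (z : R[i]) :
  Normc.normc z <= `|complex.Re z| + `|complex.Im z|.
Proof.
case: z => a b /=.
have s0 : 0 <= `|a| + `|b| by rewrite addr_ge0.
rewrite -[leRHS]ger0_norm // -sqrtr_sqr ler_wsqrtr // sqrrD !real_normK ?num_real //.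
by rewrite lerD2r lerDl mulrn_wge0 // mulr_ge0.
Qed.

Lemma continuousCP (R : realType) (M : topologicalType) (f : M -> R[i]) :
  continuousC f <->
  continuous (fun p => complex.Re (f p)) /\ continuous (fun p => complex.Im (f p)).
Proof.
split=> [cf|[cre cim] p].
  have close (p : M) (e : R) : 0 < e -> \forall q \near p, Normc.normc (f p - f q) < e.
    move=> e0; have e0' : 0 < e%:C by rewrite ltcR.
    have /cvgr_dist_lt/(_ _ e0') := cf p.
    by apply: filterS => q; rewrite -ltcR.
  split=> p; apply/cvgrPdist_lt => e e0; apply: filterS (close p e e0) => q;
    apply: le_lt_trans; case: (f p) (f q) => [a b] [c d] /=;
    by rewrite -sqrtr_sqr ler_wsqrtr // ?lerDl ?lerDr sqr_ge0.
apply/cvgrPdist_lt => -[e e']; rewrite ltcE /= => /andP[/eqP -> e0].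
have e2 : 0 < e / 2 by rewrite divr_gt0.
have nre : \forall q \near p, `|complex.Re (f p) - complex.Re (f q)| < e / 2.
  by have /cvgr_dist_lt/(_ _ e2) := cre p.
have nim : \forall q \near p, `|complex.Im (f p) - complex.Im (f q)| < e / 2.
  by have /cvgr_dist_lt/(_ _ e2) := cim p.
apply: filterS2 nre nim => q hre him.
change ((Normc.normc (f p - f q))%:C < e%:C); rewrite ltcR.
apply: le_lt_trans (normc_le_ReIm _) _; rewrite [e]splitr.
by move: hre him; case: (f p) (f q) => [a b] [c d] /=; exact: ltrD.
Qed.

Lemma sup_norm_le (R : realType) (M : topologicalType) (f : M -> R[i]) (e : R) :
  0 <= e -> (forall p, Normc.normc (f p) <= e) -> sup_norm f <= e.
Proof.
move=> e0 fe; rewrite /sup_norm.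
have [[p _]|M0] := pselect (exists p : M, True).
  by apply: ge_sup => [|_ [q _ <-]] //; exists (Normc.normc (f p)), p.
suff -> : [set Normc.normc (f p) | p in [set: M]] = set0 by rewrite sup0.
by apply/seteqP; split=> // z [p _ _] /=; apply: M0; exists p.
Qed.

Lemma sup_norm_ge0 (R : realType) (M : topologicalType) (f : M -> R[i]) :
  0 <= sup_norm f.
Proof.
rewrite /sup_norm; set S := [set _ | _ in _].
have [hS|/sup_out -> //] := pselect (has_sup S).
have [[s [p _ _]] ubS] := hS.
apply: le_trans (ub_le_sup ubS _); last by exists p.
exact: normc_ge0.
Qed.

Section Density.
Context {R : realType} {n : nat} {M : topologicalType}.
Variable X : complex_manifold R n M.
Implicit Types (u v f : M -> R[i]).

Lemma smooth_function_continuous u : smooth_function X u -> continuousC u.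
Proof.
move=> su; apply/continuousCP.
have chartwise (r : R[i] -> R) :
    (forall i, smooth_on (chart_codom (cm_atlas i))
      (fun y => r (in_chart (X := X) i u y))) -> continuous (fun p => r (u p)).
  move=> sr p; have [i dp] := cm_cover X p.
  have [/subspace_continuousP cr _] := sr i 0%N.
  have /subspace_continuousP/(_ p dp) cc :=
    @Defs.coord_continuous _ _ _ (cm_atlas i).
  have Vx : chart_codom (cm_atlas i) (Defs.coord (cm_atlas i) p) by exists p.
  have nd : nbhs p (dom (cm_atlas i)).
    by apply: open_nbhs_nbhs; split=> //; exact: dom_open.
  move=> U; rewrite -{1}(coordK dp) => /(cr _ Vx) rU.
  have {}rU := cc _ rU.
  apply: filterS2 nd rU => q dq /(_ dq).
  rewrite /= /in_chart /from_subspace coordK //; apply.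
  by exists q.
by split; [apply: (chartwise (@complex.Re R))|apply: (chartwise (@complex.Im R))];
  move=> i; case: (su i).
Qed.

(** Sums of products of a holomorphic and an antiholomorphic function. They form
    an algebra because holomorphic functions do. *)
Inductive mixed_span : (M -> R[i]) -> Prop :=
| mixed_product u v :
    smooth_function X u -> holomorphic_in_interior X u ->
    smooth_function X v -> holomorphic_in_interior X v ->
    mixed_span (fun p => u p * (v p)^*)
| mixed_sum f h : mixed_span f -> mixed_span h ->
    mixed_span (fun p => f p + h p).

Lemma mixed_spanM f h : mixed_span f -> mixed_span h ->
  mixed_span (fun p => f p * h p).
Proof.
elim=> [u v su hu sv hv|f1 f2 _ IH1 _ IH2] mh; last first.
  by under eq_fun do rewrite mulrDl; exact: mixed_sum (IH1 mh) (IH2 mh).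
elim: mh => [u' v' su' hu' sv' hv'|h1 h2 _ IH1 _ IH2]; last first.
  by under eq_fun do rewrite mulrDr; exact: mixed_sum.
under eq_fun do rewrite mulrACA -rmorphM.
by apply: (mixed_product (u := fun p => u p * u' p) (v := fun p => v p * v' p));
  do [exact: smooth_functionM|exact: holomorphicM].
Qed.

Lemma mixed_span_holomorphic u : smooth_function X u ->
  holomorphic_in_interior X u -> mixed_span u.
Proof.
move=> su hu; rewrite (_ : u = fun p => u p * (1 : R[i])^*).
  by apply: (@mixed_product u (fun=> 1)) => //;
    [exact: smooth_function_cst|exact: holomorphic_cst].
by apply/funext => p; rewrite rmorph1 mulr1.
Qed.

(** Conjugation exchanges the two factors of each product. *)
Lemma mixed_span_conj f : mixed_span f -> mixed_span (fun p => (f p)^*).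
Proof.
elim=> [u v su hu sv hv|f1 f2 _ IH1 _ IH2].
  under eq_fun do rewrite rmorphM /= conjcK mulrC.
  exact: mixed_product.
by under eq_fun do rewrite rmorphD; exact: mixed_sum.
Qed.

Lemma continuousCD f h : continuousC f -> continuousC h ->
  continuousC (fun p => f p + h p).
Proof. by move=> cf ch p; apply: cvgD; [exact: cf|exact: ch]. Qed.

Lemma mixed_span_continuous f : mixed_span f -> continuousC f.
Proof.
elim=> [u v su _ sv _|f1 f2 _ c1 _ c2]; last exact: continuousCD.
apply: smooth_function_continuous; apply: smooth_functionM => //.
exact: smooth_function_conj.
Qed.

Definition real_mixed_span : set (M -> R) :=
  [set a | mixed_span (fun p => (a p)%:C)].

Lemma real_mixed_span_subalgebra : subalgebra real_mixed_span.
Proof.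
split=> [a /mixed_span_continuous/continuousCP[] //|c|a b Aa Ab|a b Aa Ab].
- by apply: mixed_span_holomorphic;
    [exact: smooth_function_cst|exact: holomorphic_cst].
- rewrite /real_mixed_span /=; under eq_fun do rewrite rmorphD.
  exact: mixed_sum.
- rewrite /real_mixed_span /=; under eq_fun do rewrite rmorphM.
  exact: mixed_spanM.
Qed.

Lemma real_mixed_span_Re u : smooth_function X u ->
  holomorphic_in_interior X u ->
  real_mixed_span (fun p => complex.Re (u p)).
Proof.
move=> su hu; have mu := mixed_span_holomorphic su hu.
have mc : mixed_span (fun=> (2^-1)%:C).
  by apply: mixed_span_holomorphic;
    [exact: smooth_function_cst|exact: holomorphic_cst].
have := mixed_spanM mc (mixed_sum mu (mixed_span_conj mu)).
rewrite /real_mixed_span /=; congr mixed_span; apply/funext => p.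
case: (u p) => a b /=.
by apply/eqP; rewrite eq_complex /=; apply/andP; split; apply/eqP; field.
Qed.

Lemma real_mixed_span_separates : holomorphically_separable X ->
  forall p q : M, p <> q -> exists2 a, real_mixed_span a & a p <> a q.
Proof.
move=> sep p q /sep[u [su hu upq]].
have [repq|] := pselect (complex.Re (u p) = complex.Re (u q)); last first.
  by exists (fun r => complex.Re (u r)) => //; exact: real_mixed_span_Re.
(* The imaginary part of [u] is the real part of [- i u]. *)
pose w r := (0 -i* 1) * u r.
have sc := @smooth_function_cst _ _ _ X (0 -i* 1).
have hc := @holomorphic_cst _ _ _ X (0 -i* 1).
exists (fun r => complex.Re (w r)).
  apply: real_mixed_span_Re; first exact: smooth_functionM sc su.
  exact: holomorphicM sc su hc hu.
rewrite /w; move: upq repq.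
case: (u p) (u q) => [a b] [c d] /= upq ac; rewrite !mul0r !sub0r !mulN1r !opprK.
by move=> bd; apply: upq; rewrite ac bd.
Qed.

End Density.

Lemma continuousC_real (R : realType) (M : topologicalType) (v : M -> R) :
  continuous v -> continuousC (fun p => (v p)%:C).
Proof. by move=> cv; apply/continuousCP; split=> //= p; exact: cvg_cst. Qed.

(** A bounded measure is continuous for uniform convergence, so that what it
    annihilates is closed under uniform limits. *)
Lemma bounded_measure_closure (R : realType) (M : topologicalType)
    (mu : bounded_measure R M) (A : set (M -> R)) v :
  (forall a, A a -> continuous a) -> (forall a, A a -> mu (fun p => (a p)%:C) = 0) ->
  continuous v -> unif_closure A v -> mu (fun p => (v p)%:C) = 0.
Proof.
move=> cA muA cv clv; apply: Normc.eq0_normc; apply/eqP.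
rewrite eq_le normc_ge0 andbT; apply/ler_addgt0Pl => e e0; rewrite addr0.
have [K muK] := bm_bounded mu.
have K0 : 0 < `|K| + 1 by rewrite ltr_wpDl.
have [a Aa va] := clv _ (divr_gt0 e0 K0).
have ca := continuousC_real (cA a Aa).
have cva : continuousC (fun p => (v p - a p)%:C).
  by apply: continuousC_real => p; apply: cvgB; [exact: cv|exact: cA].
have -> : mu (fun p => (v p)%:C) = mu (fun p => (v p - a p)%:C).
  rewrite -[RHS]addr0 -(muA a Aa) -bm_add //; congr (mu _).
  by apply/funext => p; rewrite -rmorphD subrK.
apply: le_trans (muK _ cva) _.
have s_le : sup_norm (fun p => (v p - a p)%:C) <= e / (`|K| + 1).
  apply: sup_norm_le => [|p]; first by rewrite ltW ?divr_gt0.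
  by rewrite /= expr0n addr0 sqrtr_sqr.
apply: le_trans (ler_wpM2r (sup_norm_ge0 _) (ler_norm K)) _.
apply: le_trans (ler_wpM2l (normr_ge0 K) s_le) _.
rewrite mulrCA ler_piMr ?(ltW e0) // ler_pdivrMr // mul1r lerDl //.
Qed.

Theorem theorem1p3 (R : realType) (n : nat) (M : topologicalType)
    (X : complex_manifold R n M) (g : kahler_metric X)
    (compact_M : compact [set: M])
    (separable_M : holomorphically_separable X)
    (mu : bounded_measure R M)
    (mu_orth : forall u1 u2 : M -> R[i],
      smooth_function X u1 -> smooth_function X u2 ->
      harmonic_function g u1 -> harmonic_function g u2 ->
      mu (fun p => u1 p * u2 p) = 0) :
  forall f : M -> R[i], continuousC f -> mu f = 0.
Proof.
have mu_span f : mixed_span X f -> mu f = 0.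
  elim=> [u v su hu sv hv|f1 f2 s1 mu1 s2 mu2].
    apply: mu_orth => //; first exact: smooth_function_conj.
      exact: holomorphic_harmonic.
    exact: conj_holomorphic_harmonic.
  have c1 := mixed_span_continuous s1; have c2 := mixed_span_continuous s2.
  by rewrite bm_add // mu1 mu2 addr0.
have algA := real_mixed_span_subalgebra X.
have mu_real (v : M -> R) : continuous v -> mu (fun p => (v p)%:C) = 0.
  move=> cv; apply: (@bounded_measure_closure _ _ mu (real_mixed_span X)) => //.
  - by move=> a Aa; exact: (subalgebra_continuous algA Aa).
  - by move=> a Aa; exact: mu_span.
  - apply: stone_weierstrass => //.
    by move=> p q pq; exact: real_mixed_span_separates.
move=> f /continuousCP[cre cim].
have -> : f = fun p => (complex.Re (f p))%:C + 'i * (complex.Im (f p))%:C.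
  by apply/funext => p; exact: complexE.
have cI : continuousC (fun p => 'i * (complex.Im (f p))%:C).
  apply/continuousCP; split.
    rewrite (_ : (fun p => _) = fun=> 0); first by move=> p; exact: cvg_cst.
    by apply/funext => p /=; rewrite mul0r mul1r subrr.
  rewrite (_ : (fun p => _) = fun p => complex.Im (f p)) //.
  by apply/funext => p /=; rewrite mul0r mul1r add0r.
rewrite (bm_add _ (continuousC_real cre) cI).
by rewrite (bm_scale _ _ (continuousC_real cim)) !mu_real // mulr0 addr0.
Qed.
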